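(* The class of regular $F$-manifolds coincides with the class of Nijenhuis manifolds with a cyclic unity. Precisely, for a manifold $\mathsf M^n$, the assignment $(\mathsf M^n,\circ,e,E)\mapsto(\mathsf M^n,L,e)$, where $L\xi:=E\circ\xi$, is a one-to-one correspondence between regular $F$-manifold structures on $\mathsf M^n$ and pairs $(L,e)$ such that $(\mathsf M^n,L,e)$ is a Nijenhuis manifold with a unity and $e$ is cyclic for $L$; that is, for every regular $F$-manifold $(\mathsf M^n,\circ,e,E)$ the triple $(\mathsf M^n,E\circ,e)$ is a Nijenhuis manifold with a cyclic unity, and every Nijenhuis manifold with a cyclic unity arises in this way from exactly one regular $F$-manifold.
   Context: Smooth or real-analytic category. An $F$-manifold $(\mathsf M^n,\circ,e,E)$ is a manifold with vector fields $e,E$ and a $(1,2)$-tensor field $a$, inducing a bilinear operation $\xi\circ\eta=a(\xi,\eta)$ on vector fields, such that: (1) $\circ$ is commutative and associative; (2) $e$ is the unity of $\circ$; (3) for all vector fields $\xi,\eta,\zeta,\theta$, $$0=[\xi\circ\eta,\zeta\circ\theta]-[\xi\circ\eta,\zeta]\circ\theta-\zeta\circ[\xi\circ\eta,\theta]-\xi\circ[\eta,\zeta\circ\theta]+\xi\circ[\eta,\zeta]\circ\theta+\xi\circ\zeta\circ[\eta,\theta]-\eta\circ[\xi,\zeta\circ\theta]+\eta\circ[\xi,\zeta]\circ\theta+\eta\circ\zeta\circ[\xi,\theta];$$ (4) for all vector fields $\xi,\eta$, $[E,\xi\circ\eta]-[E,\xi]\circ\eta-\xi\circ[E,\eta]=\xi\circ\eta$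 ($E$ is an Euler vector field). A linear operator on an $n$-dimensional space is $\mathrm{gl}$-regular if each of its (complex) eigenvalues has exactly one Jordan block, equivalently there is a cyclic vector, i.e. a vector $\xi$ with $\xi,L\xi,\dots,L^{n-1}\xi$ linearly independent. The $F$-manifold is regular if the operator field $L:=E\circ$ is $\mathrm{gl}$-regular at every point. For an operator field $L$ the Nijenhuis torsion is $\mathcal N_L(\xi,\eta)=[L\xi,L\eta]+L^2[\xi,\eta]-L[L\xi,\eta]-L[\xi,L\eta]$; $L$ is a Nijenhuis operator if $\mathcal N_L=0$. A triple $(\mathsf M^n,L,e)$ is a Nijenhuis manifold with a unity if $L$ is a Nijenhuis operator on $\mathsf M^n$ and $e$ is a vector field with $\mathcal L_eL=\mathrm{Id}$; the unity is cyclic if $e$ is a cyclic vector for $L$ at every point. It is a known fact that for every $F$-manifold the operator field $E\circ$ is a Nijenhuis operator (Arsie–Lorenzoni). *)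

(* Defs.v *)
From HB Require Import structures.
From mathcomp Require Import all_boot all_order all_algebra.
From mathcomp Require Import complex.
From mathcomp Require Import all_classical all_reals all_analysis.

Set Implicit Arguments.
Unset Strict Implicit.
Unset Printing Implicit Defensive.

Import Order.TTheory GRing.Theory Num.Theory.
Import numFieldNormedType.Exports.

Local Open Scope classical_set_scope.
Local Open Scope ring_scope.

(* [D] is meant to be open; then [differentiable] and ['D_v f] at a point of
   [D] do not depend on the (arbitrary) values of [f] outside [D]. *)
Fixpoint Ck (R : realType) (V W : normedModType R) (k : nat) (D : set V)
    (f : V -> W) : Prop :=
  if k is k'.+1 then
    (forall x, D x -> differentiable f x) /\
    (forall v, Ck k' D (fun x => 'D_v f x))
  else forall x, D x -> {for x, continuous f}.

(* A multi-index of total degree d has all its entries at most d, hence the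
   finite type of the summation index.  Convergence of the
   series of absolute values makes the order of summation irrelevant. *)
Definition homogeneous_part (R : realType) (n : nat) (c : ('I_n -> nat) -> R)
    (x : 'cV[R]_n) (d : nat) : R :=
  \sum_(m : {ffun 'I_n -> 'I_d.+1} | (\sum_i m i == d)%N)
     c (fun i => m i : nat) * \prod_i x i 0 ^+ m i.

Definition has_power_series_at (R : realType) (n : nat) (f : 'cV[R]_n -> R)
    (a : 'cV[R]_n) : Prop :=
  exists (c : ('I_n -> nat) -> R) (r : R), 0 < r /\
    forall x, ball a r x ->
      cvgn (series (homogeneous_part (fun m => `|c m|)
                                     (map_mx Num.norm (x - a)))) /\
      series (homogeneous_part c (x - a)) @ \oo --> f x.

Inductive smoothness : Set := Cinfty | Comega.

Definition of_class (R : realType) (s : smoothness) (n p q : nat)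
    (D : set 'cV[R]_n) (f : 'cV[R]_n -> 'M[R]_(p, q)) : Prop :=
  (forall k, Ck k D f) /\
  (s = Comega -> forall a, D a -> forall i j,
     has_power_series_at (fun x => f x i j) a).

Record chart (R : realType) (n : nat) (T : topologicalType) := Chart {
  chart_dom : set T;
  chart_map : T -> 'cV[R]_n;
  chart_inv : 'cV[R]_n -> T;
  chart_dom_open : open chart_dom;
  chart_img_open : open (chart_map @` chart_dom);
  chart_map_cont : {within chart_dom, continuous chart_map};
  chart_inv_cont : {within chart_map @` chart_dom, continuous chart_inv};
  chart_mapK : forall p, chart_dom p -> chart_inv (chart_map p) = p }.

Definition transition (R : realType) (n : nat) (T : topologicalType)
    (c d : chart R n T) : 'cV[R]_n -> 'cV[R]_n :=
  fun x => chart_map d (chart_inv c x).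

Record manifold (R : realType) (s : smoothness) (n : nat) := Manifold {
  points :> topologicalType;
  manifold_hausdorff : hausdorff_space points;
  manifold_second_countable : @second_countable points;
  chart_index : Type;
  atlas : chart_index -> chart R n points;
  atlas_cover : forall p, exists i, chart_dom (atlas i) p;
  atlas_compat : forall i j,
    of_class s (chart_map (atlas i) @`
                  (chart_dom (atlas i) `&` chart_dom (atlas j)))
      (transition (atlas i) (atlas j)) }.

Definition dom (R : realType) (s : smoothness) (n : nat) (M : manifold R s n)
    (i : chart_index M) : set M := chart_dom (atlas i).

Definition trans (R : realType) (s : smoothness) (n : nat)
    (M : manifold R s n) (i j : chart_index M) : 'cV[R]_n -> 'cV[R]_n :=
  transition (atlas i) (atlas j).

Definition coords (R : realType) (s : smoothness) (n : nat)
    (M : manifold R s n) (i : chart_index M) (W : set M) : set 'cV[R]_n :=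
  chart_map (atlas i) @` (dom i `&` W).

(* A tensor field is given by its components in every chart of the atlas, as
   functions of the coordinates, subject to the tensorial transformation law
   under changes of charts.  The values outside the coordinate domain are
   irrelevant, so equality of fields is [agree].  The differential at x of the
   change of coordinates maps v to ['D_v (trans i j) x]. *)

Definition field_of (R : realType) (s : smoothness) (n : nat)
    (M : manifold R s n) (T : Type) : Type := chart_index M -> 'cV[R]_n -> T.

Definition agree (R : realType) (s : smoothness) (n : nat)
    (M : manifold R s n) (T : Type) (f g : field_of M T) : Prop :=
  forall i x, coords i [set: M] x -> f i x = g i x.

Definition is_vector_field (R : realType) (s : smoothness) (n : nat)
    (M : manifold R s n) (W : set M) (X : field_of M 'cV[R]_n) : Prop :=
  (forall i, of_class s (coords i W) (X i)) /\
  (forall i j x, coords i (dom j `&` W) x ->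
     X j (trans i j x) = 'D_(X i x) (trans i j) x).

Definition is_operator_field (R : realType) (s : smoothness) (n : nat)
    (M : manifold R s n) (L : field_of M 'M[R]_n) : Prop :=
  (forall i, of_class s (coords i [set: M]) (L i)) /\
  (forall i j x v, coords i (dom j) x ->
     L j (trans i j x) *m 'D_v (trans i j) x =
     'D_(L i x *m v) (trans i j) x).

(* A bilinear map on R^n is stored as the family c of the matrices of left
   multiplication by the basis vectors: c k l m is the l-th coordinate of the
   product of the k-th and m-th basis vectors. *)
Definition bilin (R : realType) (n : nat) (c : 'I_n -> 'M[R]_n)
    (u v : 'cV[R]_n) : 'cV[R]_n := \sum_k u k 0 *: (c k *m v).

Definition left_mult (R : realType) (n : nat) (c : 'I_n -> 'M[R]_n)
    (u : 'cV[R]_n) : 'M[R]_n := \sum_k u k 0 *: c k.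

Definition is_tensor12_field (R : realType) (s : smoothness) (n : nat)
    (M : manifold R s n) (a : field_of M ('I_n -> 'M[R]_n)) : Prop :=
  (forall i k, of_class s (coords i [set: M]) (fun x => a i x k)) /\
  (forall i j x u v, coords i (dom j) x ->
     bilin (a j (trans i j x)) ('D_u (trans i j) x) ('D_v (trans i j) x) =
     'D_(bilin (a i x) u v) (trans i j) x).

Definition lie (R : realType) (n : nat) (X Y : 'cV[R]_n -> 'cV[R]_n) :
    'cV[R]_n -> 'cV[R]_n :=
  fun x => 'D_(X x) Y x - 'D_(Y x) X x.

Definition app (R : realType) (n : nat) (L : 'cV[R]_n -> 'M[R]_n)
    (X : 'cV[R]_n -> 'cV[R]_n) : 'cV[R]_n -> 'cV[R]_n :=
  fun x => L x *m X x.

Definition mul (R : realType) (n : nat) (a : 'cV[R]_n -> 'I_n -> 'M[R]_n)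
    (X Y : 'cV[R]_n -> 'cV[R]_n) : 'cV[R]_n -> 'cV[R]_n :=
  fun x => bilin (a x) (X x) (Y x).

Definition hertling_manin (R : realType) (n : nat)
    (a : 'cV[R]_n -> 'I_n -> 'M[R]_n) (X Y Z T : 'cV[R]_n -> 'cV[R]_n)
    (x : 'cV[R]_n) : 'cV[R]_n :=
  let m := mul a in
  lie (m X Y) (m Z T) x - m (lie (m X Y) Z) T x - m Z (lie (m X Y) T) x
  - m X (lie Y (m Z T)) x + m (m X (lie Y Z)) T x + m (m X Z) (lie Y T) x
  - m Y (lie X (m Z T)) x + m (m Y (lie X Z)) T x + m (m Y Z) (lie X T) x.

Definition torsion (R : realType) (n : nat) (L : 'cV[R]_n -> 'M[R]_n)
    (X Y : 'cV[R]_n -> 'cV[R]_n) (x : 'cV[R]_n) : 'cV[R]_n :=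
  lie (app L X) (app L Y) x + app L (app L (lie X Y)) x
  - app L (lie (app L X) Y) x - app L (lie X (app L Y)) x.

(* Identities "for all vector fields" are required for all vector fields
   on an arbitrary open subset W of M (all of them are tensorial, and real-
   analytic local fields cannot be extended by means of bump functions). *)

Record F_structure (R : realType) (s : smoothness) (n : nat)
    (M : manifold R s n) := FStructure {
  fprod : field_of M ('I_n -> 'M[R]_n);
  funit : field_of M 'cV[R]_n;
  feuler : field_of M 'cV[R]_n }.

Definition F_agree (R : realType) (s : smoothness) (n : nat)
    (M : manifold R s n) (F G : F_structure M) : Prop :=
  [/\ agree (fprod F) (fprod G), agree (funit F) (funit G)
    & agree (feuler F) (feuler G)].

Record is_F_manifold (R : realType) (s : smoothness) (n : nat)
    (M : manifold R s n) (F : F_structure M) : Prop := IsFManifold {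
  fprod_tensor : is_tensor12_field (fprod F);
  funit_field : is_vector_field [set: M] (funit F);
  feuler_field : is_vector_field [set: M] (feuler F);
  fprod_comm : forall i x, coords i [set: M] x ->
    commutative (bilin (fprod F i x));
  fprod_assoc : forall i x, coords i [set: M] x ->
    associative (bilin (fprod F i x));
  fprod_unit : forall i x, coords i [set: M] x ->
    left_id (funit F i x) (bilin (fprod F i x));
  fprod_hertling_manin : forall (W : set M) (X Y Z T : field_of M 'cV[R]_n),
    open W -> is_vector_field W X -> is_vector_field W Y ->
    is_vector_field W Z -> is_vector_field W T ->
    forall i x, coords i W x ->
      hertling_manin (fprod F i) (X i) (Y i) (Z i) (T i) x = 0;
  feuler_axiom : forall (W : set M) (X Y : field_of M 'cV[R]_n),
    open W -> is_vector_field W X -> is_vector_field W Y ->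
    forall i x, coords i W x ->
      let m := mul (fprod F i) in
      lie (feuler F i) (m (X i) (Y i)) x - m (lie (feuler F i) (X i)) (Y i) x
      - m (X i) (lie (feuler F i) (Y i)) x = m (X i) (Y i) x }.

Definition euler_operator (R : realType) (s : smoothness) (n : nat)
    (M : manifold R s n) (F : F_structure M) : field_of M 'M[R]_n :=
  fun i x => left_mult (fprod F i x) (feuler F i x).

Definition jordan_block (K : nzRingType) (a : K) (m : nat) : 'M[K]_m :=
  \matrix_(i, j) (a *+ (i == j) + (i.+1 == j :> nat)%:R).

(* The complexification of A has a Jordan normal form whose blocks have
   pairwise distinct eigenvalues.  P and Q are mutually inverse matrices
   between R^n and R^(\sum_i m i). *)
Definition gl_regular (R : realType) (n : nat) (A : 'M[R]_n) : Prop :=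
  exists (k : nat) (a : 'I_k -> R[i]) (m : 'I_k -> nat)
    (P : 'M[R[i]]_(n, \sum_i m i)) (Q : 'M[R[i]]_(\sum_i m i, n)),
  [/\ injective a, forall i, (0 < m i)%N, P *m Q = 1%:M, Q *m P = 1%:M
    & map_mx (real_complex R) A =
      P *m (\mxdiag_i jordan_block (a i) (m i)) *m Q].

Definition regular_F (R : realType) (s : smoothness) (n : nat)
    (M : manifold R s n) (F : F_structure M) : Prop :=
  is_F_manifold F /\
  forall i x, coords i [set: M] x -> gl_regular (euler_operator F i x).

Record is_nijenhuis_unity (R : realType) (s : smoothness) (n : nat)
    (M : manifold R s n) (L : field_of M 'M[R]_n) (e : field_of M 'cV[R]_n) :
    Prop := IsNijenhuisUnity {
  nijenhuis_operator : is_operator_field L;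
  nijenhuis_unity : is_vector_field [set: M] e;
  nijenhuis_torsion : forall (W : set M) (X Y : field_of M 'cV[R]_n),
    open W -> is_vector_field W X -> is_vector_field W Y ->
    forall i x, coords i W x -> torsion (L i) (X i) (Y i) x = 0;
  (* (L_e L) X = [e, L X] - L [e, X] *)
  nijenhuis_lie_unity : forall (W : set M) (X : field_of M 'cV[R]_n),
    open W -> is_vector_field W X ->
    forall i x, coords i W x ->
      lie (e i) (app (L i) (X i)) x - app (L i) (lie (e i) (X i)) x = X i x }.

Definition cyclic_vector (R : realType) (n : nat) (A : 'M[R]_n)
    (v : 'cV[R]_n) : Prop :=
  free [seq iter k (mulmx A) v | k <- iota 0 n].

Definition nijenhuis_cyclic_unity (R : realType) (s : smoothness) (n : nat)
    (M : manifold R s n) (L : field_of M 'M[R]_n) (e : field_of M 'cV[R]_n) :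
    Prop :=
  is_nijenhuis_unity L e /\
  forall i x, coords i [set: M] x -> cyclic_vector (L i x) (e i x).

(* Main.v *)
Require Import Defs.
From HB Require Import structures.
From mathcomp Require Import all_boot all_order all_algebra.
From mathcomp Require Import complex.
From mathcomp Require Import all_classical all_reals all_analysis.
From mathcomp Require Import ring lra zify.

(** Let L be multiplication by the Euler field E of a regular F-manifold.  The
    Hertling-Manin identity for (e, e, E, X) and (E, X, E, Y), combined with
    the Euler condition for (e, e), (E, X) and (E, Y), yields L_e L = Id and the
    vanishing of the torsion of L; this is commutative algebra in each tangent
    space ([lie_unity_of_hm], [torsion_of_hm]).  A polynomial p with p(L) e = 0
    satisfies p(L) = 0, because L is a multiplication and e the unit; since the
    minimal polynomial of a gl-regular operator has degree n, the unit is
    cyclic ([gl_regular_unit_cyclic]).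

    Conversely, let (L, e) be a Nijenhuis operator with a cyclic unity.  The
    product must satisfy L^i e o L^j e = L^(i+j) e, so it is the product of the
    polynomials in L, transported to vectors by p(L) |-> p(L) e; this gives
    uniqueness ([nijenhuis_F_unique]) and the pointwise axioms.  For the
    differential axioms, the vanishing torsion and L_e L = Id imply the Witt
    relations [L^i e, L^j e] = (j - i) L^(i+j-1) e ([lie_power_field]), from
    which the Hertling-Manin identity and the Euler condition on the fields
    L^k e are identities between integers.  For a commutative associative
    product both expressions are tensorial ([hertling_maninE],
    [euler_defectE]), and the vectors L^k e with k < n form a basis at every
    point; so the axioms hold for all vector fields ([cyc_hertling_manin],
    [cyc_euler]).  Finally an operator with a cyclic vector is gl-regular,
    since over the complex numbers it has the same companion matrix as a Jordan
    matrix with one block for each eigenvalue ([cyclic_gl_regular]).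

    The structure constants of the product are rational functions of the
    components of L and e, the denominator being the determinant of the vectors
    e, L e, ..., L^(n-1) e.  So they are as regular as L and e, provided
    that smooth and analytic functions are closed under sums, products and
    inverses.  For analytic functions this is the theorem on Cauchy products, and a
    majorant for the recursion that computes the inverse power series
    ([has_power_series_mul], [has_power_series_inv]). *)

Set Implicit Arguments.
Unset Strict Implicit.
Unset Printing Implicit Defensive.

Import Order.TTheory GRing.Theory Num.Theory.
Import numFieldNormedType.Exports.

Local Open Scope classical_set_scope.
Local Open Scope ring_scope.

(** * Cauchy products of series *)

Section CauchyProduct.
Variable R : realType.
Implicit Types u v U V : R^nat.

Definition cauchy_product u v : R^nat :=
  fun d => \sum_(i < d.+1) u i * v (d - i)%N.

(** Summing the triangle i + j < N by columns: for a fixed i, the index j runs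
    below N - i. *)
Lemma series_cauchy_product u v N :
  series (cauchy_product u v) N = \sum_(i < N) u i * series v (N - i)%N.
Proof.
elim: N => [|N IH]; first by rewrite /series /= big_geq ?big_ord0.
rewrite seriesSr IH /cauchy_product !big_ord_recr /= addrA -big_split /=.
rewrite subnn subSnn seriesSr [series v 0]/series /= big_geq// add0r.
congr (_ + _); apply: eq_bigr => i _.
by rewrite -mulrDr subSn 1?ltnW// seriesSr.
Qed.

Lemma le_series_nat U m N : (forall d, 0 <= U d) -> (m <= N)%N ->
  series U m <= series U N.
Proof.
move=> U0 mN; rewrite /series /= (big_cat_nat (n := m) (p := N))//= lerDl.
exact: sumr_ge0.
Qed.

Lemma series_ge0 U N : (forall d, 0 <= U d) -> 0 <= series U N.
Proof. by move=> U0; apply: sumr_ge0. Qed.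

Lemma cauchy_product_ge0 U V : (forall d, 0 <= U d) -> (forall d, 0 <= V d) ->
  forall d, 0 <= cauchy_product U V d.
Proof. by move=> U0 V0 d; apply: sumr_ge0 => i _; apply: mulr_ge0. Qed.

Lemma le_series_cauchy_product U V N :
  (forall d, 0 <= U d) -> (forall d, 0 <= V d) ->
  series (cauchy_product U V) N <= series U N * series V N.
Proof.
move=> U0 V0; rewrite series_cauchy_product [series U N]/series /= big_mkord.
rewrite mulr_suml; apply: ler_sum => i _; rewrite ler_wpM2l//.
by rewrite le_series_nat// leq_subr.
Qed.

(** The square of side N/2 is contained in the triangle i + j < N.  Together
    with [le_series_cauchy_product], which encloses the triangle in the square of
    side N, this squeezes the partial sums of the Cauchy product. *)
Lemma ge_series_cauchy_product U V N :
  (forall d, 0 <= U d) -> (forall d, 0 <= V d) ->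
  series U N./2 * series V N./2 <= series (cauchy_product U V) N.
Proof.
move=> U0 V0; rewrite series_cauchy_product [series U _]/series /= big_mkord.
have hN : (N./2 <= N)%N by rewrite -[leqRHS]odd_double_half -addnn addnA leq_addl.
rewrite mulr_suml (big_ord_widen N (fun i => U i * series V N./2))// big_mkcond.
apply: ler_sum => i _; case: ifP => [iN|_].
  rewrite ler_wpM2l// le_series_nat//; lia.
by rewrite mulr_ge0// series_ge0.
Qed.

(** Both sides sum over the part i + j >= N of the square of side N: on the
    right the majorants, whose total tends to 0. *)
Lemma dist_series_cauchy_product u v U V N :
  (forall d, `|u d| <= U d) -> (forall d, `|v d| <= V d) ->
  `|series u N * series v N - series (cauchy_product u v) N| <=
  series U N * series V N - series (cauchy_product U V) N.
Proof.
move=> uU vV; rewrite !series_cauchy_product [series u _]/series.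
rewrite [series U _]/series /= !big_mkord !mulr_suml -!sumrB.
apply: (le_trans (ler_norm_sum _ _ _)); apply: ler_sum => i _.
rewrite -!mulrBr normrM ler_pM// !sub_series_geq ?leq_subr//.
by apply: (le_trans (ler_norm_sum _ _ _)); apply: ler_sum.
Qed.

Lemma cvg_series_cauchy_product u v U V :
  (forall d, `|u d| <= U d) -> (forall d, `|v d| <= V d) ->
  cvgn (series U) -> cvgn (series V) ->
  cvgn (series (cauchy_product U V)) /\
  forall a b : R, series u @ \oo --> a -> series v @ \oo --> b ->
  series (cauchy_product u v) @ \oo --> a * b.
Proof.
move=> uU vV cU cV.
have U0 d : 0 <= U d by apply: le_trans (uU d).
have V0 d : 0 <= V d by apply: le_trans (vV d).
have cUV : series U \* series V @ \oo --> limn (series U) * limn (series V).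
  exact: cvgM cU cV.
have half : (fun N => N./2) @ \oo --> \oo.
  move=> A [M _ MA]; exists M.*2 => // N /= MN; apply: MA => /=.
  by rewrite -(doubleK M) half_leq.
have cp : series (cauchy_product U V) @ \oo --> limn (series U) * limn (series V).
  apply: (squeeze_cvgr _ (cvg_comp _ _ half cUV) cUV).
  near=> N; rewrite le_series_cauchy_product// andbT.
  exact: ge_series_cauchy_product.
split; first by apply/cvg_ex; eexists; exact: cp.
move=> a b ua vb.
have uv : series u \* series v @ \oo --> a * b by exact: cvgM ua vb.
have d0 : (fun N => series u N * series v N - series (cauchy_product u v) N)
    @ \oo --> (0 : R).
  apply: norm_cvg0.
  have Z : (fun N => series U N * series V N - series (cauchy_product U V) N)
    @ \oo --> (0 : R).
    by rewrite -(subrr (limn (series U) * limn (series V))); exact: cvgB cUV cp.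
  apply: (squeeze_cvgr _ (cvg_cst 0) Z).
  near=> N; rewrite normr_ge0 /=; exact: dist_series_cauchy_product.
have -> : series (cauchy_product u v) = (series u \* series v) \-
  (fun N => series u N * series v N - series (cauchy_product u v) N).
  by apply/funext => N /=; rewrite opprB addrC subrK.
by rewrite -[X in _ --> X]subr0; exact: cvgB uv d0.
Unshelve. all: by end_near. Qed.

End CauchyProduct.

(** * Products of power series in several variables *)

Section MultiIndex.
Variables (R : realType) (n : nat).
Notation mi := ('I_n -> nat).
Implicit Types (c : mi -> R) (x : 'cV[R]_n).

Definition degree (m : mi) : nat := \sum_i m i.

(** A finite function with values in a bounded interval is seen as a
    multi-index, so that sums over boxes of various sizes can be compared: the
    homogeneous part of degree d and the convolution below are sums over boxes
    whose size depends on d, respectively on the multi-index. *)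
Definition box_index N (f : {ffun 'I_n -> 'I_N.+1}) : mi := fun i => f i.

(** A box that already contains the support of the sum can be enlarged at will,
    which brings sums over different boxes to a common index type. *)
Lemma box_sum (P : pred mi) (F : mi -> R) d N : (d <= N)%N ->
  (forall m, P m -> forall i, (m i <= d)%N) ->
  \sum_(f : {ffun 'I_n -> 'I_d.+1} | P (box_index f)) F (box_index f) =
  \sum_(f : {ffun 'I_n -> 'I_N.+1} | P (box_index f)) F (box_index f).
Proof.
move=> dN Pd.
pose w (f : {ffun 'I_n -> 'I_d.+1}) : {ffun 'I_n -> 'I_N.+1} :=
  [ffun i => inord (f i)].
pose w' (f : {ffun 'I_n -> 'I_N.+1}) : {ffun 'I_n -> 'I_d.+1} :=
  [ffun i => inord (f i)].
have wE f : box_index (w f) = box_index f.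
  apply/funext => i; rewrite /box_index ffunE inordK//.
  by rewrite ltnS (leq_trans _ dN)// -ltnS.
rewrite [RHS](reindex_onto w w'); last first.
  move=> f Pf; apply/ffunP => i; apply: val_inj; rewrite !ffunE /=.
  have fd : (f i <= d)%N := Pd _ Pf i.
  by rewrite !inordK ?ltnS// (leq_trans fd).
apply: eq_big => [f|f _]; rewrite ?wE//.
rewrite andbC; apply/esym/andb_idl => _; apply/eqP/ffunP => i; apply: val_inj.
have := congr1 (@^~ i) (wE f); rewrite /box_index !ffunE /= => ->.
by rewrite inordK.
Qed.

Lemma le_degree (m : mi) i : (m i <= degree m)%N.
Proof. by rewrite /degree (bigD1 i)//= leq_addr. Qed.

Lemma homogeneous_part_box c x d N : (d <= N)%N ->
  homogeneous_part c x d =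
  \sum_(f : {ffun 'I_n -> 'I_N.+1} | degree (box_index f) == d)
     c (box_index f) * \prod_i x i 0 ^+ box_index f i.
Proof.
move=> dN; rewrite -(@box_sum (fun m => degree m == d)
  (fun m => c m * \prod_i x i 0 ^+ m i) _ _ dN)//.
by move=> m /eqP<-; exact: le_degree.
Qed.

(** The coefficients of the product of two power series; every k <= m has its
    entries bounded by the degree of m. *)
Definition conv_coef c c' : mi -> R := fun m =>
  \sum_(f : {ffun 'I_n -> 'I_(degree m).+1} |
         [forall i, (box_index f i <= m i)%N])
     c (box_index f) * c' (fun i => m i - box_index f i)%N.

Lemma conv_coef_box c c' m N : (degree m <= N)%N ->
  conv_coef c c' m =
  \sum_(f : {ffun 'I_n -> 'I_N.+1} | [forall i, (box_index f i <= m i)%N])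
     c (box_index f) * c' (fun i => m i - box_index f i)%N.
Proof.
move=> mN; rewrite -(@box_sum (fun k : mi => [forall i, (k i <= m i)%N])
  (fun k => c k * c' (fun i => m i - k i)%N) _ _ mN)//.
by move=> k /forallP kP i; rewrite (leq_trans (kP i))// le_degree.
Qed.

(** A pair (k, m) with k <= m and m of degree d is the same as a pair (k, l) with
    degrees adding up to d, through m = k + l; the monomials multiply
    accordingly. *)
Lemma homogeneous_part_conv c c' x d :
  homogeneous_part (conv_coef c c') x d =
  cauchy_product (homogeneous_part c x) (homogeneous_part c' x) d.
Proof.
pose B := {ffun 'I_n -> 'I_d.+1}.
pose X (m : mi) := \prod_i x i 0 ^+ m i.
have Xadd (k l : mi) : X (fun i => k i + l i)%N = X k * X l.
  by rewrite /X -big_split; apply: eq_bigr => i _; rewrite exprD.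
have degD (k l : mi) : degree (fun i => k i + l i)%N = (degree k + degree l)%N.
  by rewrite /degree big_split.
transitivity (\sum_(k : B | (degree (box_index k) <= d)%N)
    \sum_(l : B | degree (box_index l) == (d - degree (box_index k))%N)
      (c (box_index k) * X (box_index k)) * (c' (box_index l) * X (box_index l))).
  rewrite (homogeneous_part_box _ _ (leqnn d)).
  under eq_bigr => m /eqP dm do rewrite (conv_coef_box _ _ (eq_leq dm)) mulr_suml.
  rewrite (exchange_big_dep (fun k : B => (degree (box_index k) <= d)%N))/=; last first.
    move=> m k /eqP dm /forallP km; rewrite -[leqRHS]dm.
    by apply: leq_sum => i _; exact: km.
  apply: eq_bigr => k kd.
  (* the change of index l |-> k + l inside the box, and its inverse m |-> m - k *)
  pose h (l : B) : B := [ffun i => inord (k i + l i)].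
  pose h' (m : B) : B := [ffun i => inord (m i - k i)].
  have hE (l : B) : degree (box_index l) = (d - degree (box_index k))%N ->
     box_index (h l) = fun i => (box_index k i + box_index l i)%N.
    move=> dl; apply/funext => i; rewrite /box_index ffunE inordK// ltnS.
    rewrite -[leqRHS](subnKC kd) -dl -degD.
    exact: (le_degree (fun i => (box_index k i + box_index l i)%N) i).
  rewrite (reindex_onto h h'); last first.
    move=> m /andP[_ /forallP km]; apply/ffunP => i; apply: val_inj.
    rewrite !ffunE /= [in X in (_ + X)%N]inordK; last first.
      by rewrite ltnS (leq_trans (leq_subr _ _))// -ltnS.
    by rewrite subnKC ?inordK//; exact: km.
  have h'h (l : B) : box_index (h l) = (fun i => (box_index k i + box_index l i)%N) ->
      h' (h l) = l.
    move=> hl; apply/ffunP => i; apply: val_inj; rewrite ffunE.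
    have -> : (h l i : nat) = (k i + l i)%N := congr1 (@^~ i) hl.
    by rewrite addKn /= inordK.
  apply: eq_big => [l|l].
    apply/idP/idP => [/andP[/andP[/eqP hd /forallP khl] /eqP hl]|/eqP dl].
      have hl' : box_index (h l) = (fun i => (box_index k i + box_index l i)%N).
        apply/funext => i; have := congr1 (fun g : B => box_index g i) hl.
        rewrite /box_index /= [h' _ i]ffunE inordK; last first.
          by rewrite ltnS (leq_trans (leq_subr _ _))// -ltnS.
        by move=> <-; rewrite subnKC//; exact: khl.
      by rewrite -[X in (X - _)%N]hd hl' degD addKn.
    rewrite (h'h _ (hE _ dl)) (hE _ dl) degD dl subnKC// !eqxx andbT /=.
    by apply/forallP => i; rewrite leq_addr.
  move=> /andP[/andP[/eqP hd /forallP khl] /eqP hl].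
  have hl' : box_index (h l) = (fun i => (box_index k i + box_index l i)%N).
    apply/funext => i; have := congr1 (fun g : B => box_index g i) hl.
    rewrite /box_index /= [h' _ i]ffunE inordK; last first.
      by rewrite ltnS (leq_trans (leq_subr _ _))// -ltnS.
    by move=> <-; rewrite subnKC//; exact: khl.
  rewrite hl' -/(X _) Xadd.
  under [X in c' X]funext => i do rewrite addKn.
  ring.
rewrite /cauchy_product.
(* group the multi-indices k by their degree i *)
rewrite (partition_big (fun k : B => inord (degree (box_index k)) : 'I_d.+1) xpredT)//=.
apply: eq_bigr => i _.
rewrite (homogeneous_part_box _ _ (ltn_ord i : (i <= d)%N)).
rewrite (homogeneous_part_box _ _ (leq_subr i d)) mulr_suml.
apply: eq_big => [k|k /andP[kd /eqP ki]].
  apply/andP/eqP => [[kd /eqP <-]|->]; first by rewrite inordK.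
  by split; [rewrite -ltnS|apply/eqP/val_inj; rewrite /= inordK].
by rewrite mulr_sumr -ki inordK.
Qed.

Lemma conv_coef_abs c c' m :
  `|conv_coef c c' m| <= conv_coef (fun m => `|c m|) (fun m => `|c' m|) m.
Proof.
apply: (le_trans (ler_norm_sum _ _ _)); apply: ler_sum => f _.
by rewrite normrM.
Qed.

End MultiIndex.

(** * Sums, products and inverses of analytic functions *)

Section PowerSeries.
Variables (R : realType) (n : nat).
Notation mi := ('I_n -> nat).
Implicit Types (c : mi -> R) (x y a : 'cV[R]_n) (f g : 'cV[R]_n -> R).

(** The common source of all the domination arguments: a homogeneous polynomial
    with smaller coefficients at a point with smaller entries is smaller. *)
Lemma homogeneous_part_majorant c c' x y d :
  (forall m, `|c m| <= c' m) -> (forall i, `|x i 0| <= y i 0) ->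
  `|homogeneous_part c x d| <= homogeneous_part c' y d.
Proof.
move=> cc' xy; apply: (le_trans (ler_norm_sum _ _ _)); apply: ler_sum => m _.
rewrite normrM normr_prod ler_pM// ?prodr_ge0//.
by apply: ler_prod => i _; rewrite normr_ge0 normrX lerXn2r ?nnegrE// (le_trans _ (xy i)).
Qed.

Lemma homogeneous_part_ge0 c x d :
  (forall m, 0 <= c m) -> (forall i, 0 <= x i 0) -> 0 <= homogeneous_part c x d.
Proof.
move=> c0 x0; apply: sumr_ge0 => m _; rewrite mulr_ge0// prodr_ge0// => i _.
exact: exprn_ge0.
Qed.

Lemma homogeneous_partD c c' x d :
  homogeneous_part (fun m => c m + c' m) x d =
  homogeneous_part c x d + homogeneous_part c' x d.
Proof. by rewrite -big_split; apply: eq_bigr => m _; rewrite mulrDl. Qed.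

Lemma homogeneous_partZ k c x d :
  homogeneous_part (fun m => k * c m) x d = k * homogeneous_part c x d.
Proof. by rewrite mulr_sumr; apply: eq_bigr => m _; rewrite mulrA. Qed.

Lemma homogeneous_part_scale c t y d :
  homogeneous_part c (t *: y) d = t ^+ d * homogeneous_part c y d.
Proof.
rewrite mulr_sumr; apply: eq_bigr => m /eqP md.
rewrite mulrCA; congr (_ * _); have -> : t ^+ d = \prod_i t ^+ m i by rewrite prodrXr md.
by rewrite -big_split; apply: eq_bigr => i _; rewrite mxE exprMn.
Qed.

Lemma homogeneous_part0 c x : homogeneous_part c x 0 = c (fun=> 0%N).
Proof.
rewrite /homogeneous_part (big_pred1 [ffun=> ord0]) => [|m].
  rewrite big1 ?mulr1; last by move=> i _; rewrite ffunE expr0.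
  by congr c; apply/funext => i; rewrite ffunE.
rewrite sum_nat_eq0; apply/forallP/eqP => [m0|-> i]; last by rewrite ffunE.
by apply/ffunP => i; rewrite ffunE; apply: val_inj => /=; exact/eqP/(implyP (m0 i)).
Qed.

Lemma eq_homogeneous_part c c' x d :
  (forall m, degree m = d -> c m = c' m) ->
  homogeneous_part c x d = homogeneous_part c' x d.
Proof. by move=> cc'; apply: eq_bigr => m /eqP md; rewrite cc'. Qed.

(** The coefficients of the constant power series 1. *)
Definition dirac0 : mi -> R := fun m => (degree m == 0%N)%:R.

Lemma homogeneous_part_dirac0 x d : homogeneous_part dirac0 x d = (d == 0%N)%:R.
Proof.
case: d => [|d].
  by rewrite homogeneous_part0 /dirac0 /degree big1.
rewrite (@eq_homogeneous_part _ (fun=> 0)) => [|m dm]; last by rewrite /dirac0 dm.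
by rewrite /homogeneous_part big1// => m _; rewrite mul0r.
Qed.

Lemma series_dirac0 : series (fun d => (d == 0%N)%:R : R) @ \oo --> (1 : R).
Proof.
apply: (@cvg_near_cst _ _ _ _ _ _) => //.
exists 1%N => // -[//|N] _ /=; rewrite /series /= big_nat_recl// big1 ?addr0//.
Qed.

Lemma abs_cvg_series c x :
  cvgn (series (homogeneous_part (fun m => `|c m|) (map_mx Num.norm x))) ->
  cvgn (series (homogeneous_part c x)).
Proof.
move=> cc; apply: normed_cvg; apply: series_le_cvg cc => d; first exact: normr_ge0.
  by apply: homogeneous_part_ge0 => // i; rewrite mxE.
by apply: homogeneous_part_majorant => // i; rewrite mxE.
Qed.

Lemma has_power_series_cst k a : has_power_series_at (fun=> k) a.
Proof.
exists (fun m => k * dirac0 m), 1; split=> // x _; split.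
  rewrite (_ : homogeneous_part _ _ = (fun d => `|k| * (d == 0%N)%:R)).
    rewrite (_ : series _ = (fun N => `|k| * series (fun d => (d == 0%N)%:R : R) N)).
      by apply: is_cvgMr; apply/cvg_ex; eexists; exact: series_dirac0.
    by apply/funext => N; rewrite /series /= mulr_sumr.
  apply/funext => d; rewrite -(homogeneous_part_dirac0 (map_mx Num.norm (x - a))).
  rewrite -homogeneous_partZ; apply: eq_homogeneous_part => m _.
  by rewrite normrM /dirac0; case: eqP => _; rewrite ?normr1 ?normr0.
rewrite (_ : series _ = (fun N => k * series (fun d => (d == 0%N)%:R : R) N)).
  by rewrite -[X in _ --> X]mulr1; apply: cvgMr; exact: series_dirac0.
apply/funext => N; rewrite /series /= mulr_sumr; apply: eq_bigr => d _.
by rewrite homogeneous_partZ homogeneous_part_dirac0.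
Qed.

Lemma has_power_series_add f g a :
  has_power_series_at f a -> has_power_series_at g a ->
  has_power_series_at (fun x => f x + g x) a.
Proof.
move=> [c [r [r0 cf]]] [c' [r' [r'0 cg]]].
exists (fun m => c m + c' m), (Num.min r r'); split; first by rewrite lt_min r0.
move=> x ax.
have [] := cf x (le_ball _ ax); first by rewrite ge_min lexx.
move=> U u; have [] := cg x (le_ball _ ax); first by rewrite ge_min lexx orbT.
move=> V v; split.
  apply: (@series_le_cvg _ _ (fun d =>
    homogeneous_part (fun m => `|c m|) (map_mx Num.norm (x - a)) d +
    homogeneous_part (fun m => `|c' m|) (map_mx Num.norm (x - a)) d)).
  - by move=> d; apply: homogeneous_part_ge0 => // i; rewrite mxE.
  - by move=> d; rewrite addr_ge0//; apply: homogeneous_part_ge0 => // i; rewrite mxE.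
  - move=> d; rewrite -homogeneous_partD.
    apply: (le_trans (ler_norm _)); apply: homogeneous_part_majorant => [m|i].
      by rewrite normr_id ler_normD.
    by rewrite !mxE normr_id.
  rewrite (_ : series _ =
      series (homogeneous_part (fun m => `|c m|) (map_mx Num.norm (x - a))) \+
      series (homogeneous_part (fun m => `|c' m|) (map_mx Num.norm (x - a)))).
    exact: is_cvgD.
  by apply/funext => N; rewrite /series /= big_split.
rewrite (_ : series _ = series (homogeneous_part c (x - a)) \+
    series (homogeneous_part c' (x - a))); first exact: cvgD u v.
apply/funext => N; rewrite /series /= -big_split; apply: eq_bigr => d _.
exact: homogeneous_partD.
Qed.

(** The coefficients are those of the formal product; the absolute values of
    its homogeneous parts are dominated by the Cauchy product of the two series of
    absolute values. *)
Lemma has_power_series_mul f g a :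
  has_power_series_at f a -> has_power_series_at g a ->
  has_power_series_at (fun x => f x * g x) a.
Proof.
move=> [c [r [r0 cf]]] [c' [r' [r'0 cg]]].
exists (conv_coef c c'), (Num.min r r'); split; first by rewrite lt_min r0.
move=> x ax.
have [] := cf x (le_ball _ ax); first by rewrite ge_min lexx.
move=> U u; have [] := cg x (le_ball _ ax); first by rewrite ge_min lexx orbT.
move=> V v.
have hE k k' y : homogeneous_part (conv_coef k k') y =
    cauchy_product (homogeneous_part k y) (homogeneous_part k' y).
  by apply/funext => d; rewrite homogeneous_part_conv.
have nrm k d : `|homogeneous_part k (x - a) d| <=
    homogeneous_part (fun m => `|k m|) (map_mx Num.norm (x - a)) d.
  by apply: homogeneous_part_majorant => // i; rewrite !mxE.
have [UV uv] := cvg_series_cauchy_product (nrm c) (nrm c') U V.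
split; last by rewrite hE; exact: uv.
apply: series_le_cvg UV => d.
- by apply: homogeneous_part_ge0 => // i; rewrite mxE.
- by apply: cauchy_product_ge0 => e; apply: homogeneous_part_ge0 => // i; rewrite mxE.
rewrite -homogeneous_part_conv; apply: (le_trans (ler_norm _)).
apply: homogeneous_part_majorant => [m|i]; first by rewrite normr_id; exact: conv_coef_abs.
by rewrite !mxE normr_id.
Qed.

Section Inverse.
Variable c : mi -> R.
Let c0 := c (fun=> 0%N).
Hypothesis c0_neq0 : c0 != 0.

Definition drop0 : mi -> R := fun m => if degree m == 0%N then 0 else c m.

(** The inverse d of c solves c * d = 1, that is, c_0 d = 1 - c' * d where c' is c
    without its constant coefficient.  So d is a fixed point of this map, whose
    value at m involves d in degrees below the degree of m only. *)
Definition inv_step (d : mi -> R) : mi -> R :=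
  fun m => c0^-1 * (dirac0 m - conv_coef drop0 d m).

(** After k iterations the coefficients of degree < k have stabilised. *)
Definition inv_coef : mi -> R := fun m => iter (degree m).+1 inv_step (fun=> 0) m.

Lemma inv_step_local N (d d' : mi -> R) :
  (forall m, (degree m < N)%N -> d m = d' m) ->
  forall m, (degree m < N.+1)%N -> inv_step d m = inv_step d' m.
Proof.
move=> dd' m mN; congr (_ * (_ - _)); apply: eq_bigr => f /forallP fm.
rewrite /drop0; case: eqVneq => [_|f0]; first by rewrite !mul0r.
rewrite dd'//; rewrite ltnS in mN; apply: leq_trans mN.
rewrite [ltnRHS](_ : _ = (degree (fun i => m i - box_index f i) + degree (box_index f))%N).
  by rewrite -addn1 leq_add2l lt0n.
by rewrite /degree -big_split /=; apply: eq_bigr => i _; rewrite subnK//; exact: fm.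
Qed.

Lemma inv_coef_iter k m : (degree m < k)%N ->
  inv_coef m = iter k inv_step (fun=> 0) m.
Proof.
have H : forall j k k' m, (j <= k)%N -> (j <= k')%N -> (degree m < j)%N ->
    iter k inv_step (fun=> 0) m = iter k' inv_step (fun=> 0) m.
  elim=> [//|j IH] [//|k1] [//|k'1] m1; rewrite !ltnS => jk jk' mj /=.
  by apply: (@inv_step_local j) => // m2 m2j; exact: IH.
by move=> mk; apply: (H (degree m).+1).
Qed.

Lemma inv_coefE m : c0 * inv_coef m = dirac0 m - conv_coef drop0 inv_coef m.
Proof.
have -> : inv_coef m = inv_step inv_coef m.
  rewrite {1}/inv_coef iterS; apply: (@inv_step_local (degree m)) => // m' m'm.
  by rewrite (inv_coef_iter m'm).
by rewrite /inv_step mulVKf.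
Qed.

Lemma homogeneous_part_drop0 x d :
  homogeneous_part drop0 x d = if d == 0%N then 0 else homogeneous_part c x d.
Proof.
case: d => [|d].
  by rewrite homogeneous_part0 /drop0 /degree big1.
by apply: eq_homogeneous_part => m dm; rewrite /drop0 dm.
Qed.

Lemma cauchy_product_inv_coef x d :
  cauchy_product (homogeneous_part c x) (homogeneous_part inv_coef x) d =
  (d == 0%N)%:R.
Proof.
have : c0 * homogeneous_part inv_coef x d = (d == 0%N)%:R -
    cauchy_product (homogeneous_part drop0 x) (homogeneous_part inv_coef x) d.
  rewrite -homogeneous_part_conv -(homogeneous_part_dirac0 x) -homogeneous_partZ.
  apply/eqP; rewrite eq_sym subr_eq -homogeneous_partD; apply/eqP.
  by apply: eq_homogeneous_part => m _; rewrite inv_coefE subrK.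
rewrite /cauchy_product !big_ord_recl !homogeneous_part_drop0/= !subn0 mul0r add0r.
rewrite !homogeneous_part0 -/c0 => ->.
rewrite -[RHS](subrK (\sum_(i < d) homogeneous_part c x (bump 0 i) *
   homogeneous_part inv_coef x (d - bump 0 i))); congr (_ - _ + _).
by apply: eq_bigr => i _; rewrite homogeneous_part_drop0.
Qed.

(** If the absolute values of the nonconstant terms of c add up to at most
    |c_0|/2 at y, then the partial sums S of the series of absolute values of the
    inverse satisfy |c_0| S <= 1 + |c_0|/2 S by the recursion defining it, hence
    they are bounded.  So the formal inverse has a positive radius of convergence. *)
Lemma inv_coef_majorant y N : (forall i, 0 <= y i 0) ->
  series (homogeneous_part (fun m => `|drop0 m|) y) N <= `|c0| / 2 ->
  series (homogeneous_part (fun m => `|inv_coef m|) y) N <= 2 / `|c0|.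
Proof.
move=> y0 T.
have C0 : 0 < `|c0| by rewrite normr_gt0.
set S := series _ N.
have S0 : 0 <= S by apply: series_ge0 => d; exact: homogeneous_part_ge0.
suff : `|c0| * S <= 1 + `|c0| / 2 * S.
  by rewrite ler_pdivlMr// => h; move: h; lra.
pose D := homogeneous_part (fun m => `|drop0 m|) y.
pose I := homogeneous_part (fun m => `|inv_coef m|) y.
have step d : `|c0| * I d <= (d == 0%N)%:R + cauchy_product D I d.
  rewrite /D /I -homogeneous_part_conv -(homogeneous_part_dirac0 y).
  rewrite -homogeneous_partZ -homogeneous_partD.
  apply: (le_trans (ler_norm _)); apply: homogeneous_part_majorant => [m|i].
    rewrite normrM !normr_id -normrM inv_coefE (le_trans (ler_normB _ _))//.
    apply: lerD; last exact: conv_coef_abs.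
    by rewrite /dirac0 ger0_norm.
  by rewrite ger0_norm.
have : `|c0| * S <= series (fun d => (d == 0%N)%:R + cauchy_product D I d) N.
  by rewrite /S /series /= mulr_sumr; apply: ler_sum => d _; exact: step.
move/le_trans; apply.
rewrite {1}/series /= big_split /=; apply: lerD.
  case: N {T S S0} => [|N]; first by rewrite big_geq.
  by rewrite big_nat_recl// big1 ?addr0.
apply: (le_trans (le_series_cauchy_product _ _ _)).
- by move=> d; exact: homogeneous_part_ge0.
- by move=> d; exact: homogeneous_part_ge0.
by rewrite ler_wpM2r.
Qed.

End Inverse.

(** On a ball small enough for [inv_coef_majorant] the formal inverse converges
    absolutely, and by the theorem on Cauchy products its sum times f is 1. *)
Lemma has_power_series_inv f a : f a != 0 ->
  has_power_series_at f a -> has_power_series_at (fun x => (f x)^-1) a.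
Proof.
move=> fa0 [c [r [r0 cf]]].
have fc : f a = c (fun=> 0%N).
  have [_ /cvg_lim <-//] := cf a (ballxx _ r0).
  apply: lim_near_cst => //; exists 1%N => // -[//|N] _ /=.
  rewrite /series /= big_nat_recl// homogeneous_part0 big1 ?addr0// => d _.
  by rewrite subrr -(scale0r (0 : 'cV[R]_n)) homogeneous_part_scale expr0n mul0r.
rewrite fc in fa0; set c0 := c _ in fa0.
pose rho := r / 2.
have rho0 : 0 < rho by rewrite divr_gt0.
pose C := homogeneous_part (fun m => `|c m|) (const_mx rho : 'cV[R]_n).
have Cge0 d : 0 <= C d.
  by apply: homogeneous_part_ge0 => // i; rewrite mxE ltW.
have cC : cvgn (series C).
  have [] := cf (a + const_mx rho).
    split=> // i j; rewrite -ball_normE /= !mxE opprD addNKr normrN gtr0_norm//.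
    by rewrite /rho; move: r0; lra.
  rewrite addrC addKr (_ : map_mx _ _ = const_mx rho)//.
  by apply/matrixP => i j; rewrite !mxE gtr0_norm.
set K := limn (series C).
have CK N : series C N <= K.
  apply: nondecreasing_cvgn_le => // p q pq; exact: le_series_nat.
have K0 : 0 <= K by apply: le_trans (CK 0%N); rewrite /series /= big_geq.
have C0 : 0 < `|c0| by rewrite normr_gt0.
(* shrinking the radius by t <= 1 multiplies the nonconstant terms by at most t, and
   this t makes t K <= |c0|/2, where K is the sum of absolute values at radius rho *)
pose t := `|c0| / (2 * K + `|c0| + 1).
have den0 : 0 < 2 * K + `|c0| + 1 by lra.
have t0 : 0 < t by rewrite divr_gt0.
have t1 : t <= 1 by rewrite ler_pdivrMr// mul1r; lra.
have tK : t * K <= `|c0| / 2.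
  rewrite /t mulrAC ler_pdivrMr// mulrAC ler_pdivlMr//.
  rewrite -mulrA ler_wpM2l//; lra.
have tr : t * rho < r.
  apply: (@le_lt_trans _ _ rho); first by rewrite ler_piMl// ltW.
  rewrite /rho; lra.
exists (inv_coef c), (t * rho); split; first by rewrite mulr_gt0.
move=> x ax.
have xi i : `|(x - a) i 0| <= t * rho.
  case: ax => _ /(_ i 0); rewrite -ball_normE /= !mxE distrC; exact: ltW.
have [U u] := cf x (le_ball (ltW tr) ax).
have T N : series (homogeneous_part (fun m => `|drop0 c m|)
    (map_mx Num.norm (x - a))) N <= `|c0| / 2.
  apply: (le_trans _ tK).
  apply: (@le_trans _ _ (t * series C N)); last by rewrite ler_wpM2l// ltW.
  rewrite /series /= mulr_sumr; apply: ler_sum => d _.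
  apply: (le_trans (ler_norm _)).
  case: d => [|d].
    rewrite homogeneous_part0 /drop0 /degree big1//= normr0 normr0.
    by rewrite mulr_ge0// ltW.
  apply: (@le_trans _ _ (homogeneous_part (fun m => `|c m|) (t *: const_mx rho) d.+1)).
    apply: homogeneous_part_majorant => [m|i].
      by rewrite normr_id /drop0; case: ifP => // _; rewrite normr0.
    by have := xi i; rewrite !mxE normr_id.
  rewrite homogeneous_part_scale ler_wpM2r//.
  by rewrite exprS ler_piMr ?exprn_ile1// ltW.
have V : cvgn (series (homogeneous_part (fun m => `|inv_coef c m|)
    (map_mx Num.norm (x - a)))).
  apply: nondecreasing_is_cvgn => [p q pq|].
    apply: le_series_nat => // d; apply: homogeneous_part_ge0 => // i.
    by rewrite mxE.
  exists (2 / `|c0|) => _ [N _ <-]; apply: inv_coef_majorant => //.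
  by move=> i; rewrite mxE.
split=> //.
have nrm k d : `|homogeneous_part k (x - a) d| <=
    homogeneous_part (fun m => `|k m|) (map_mx Num.norm (x - a)) d.
  by apply: homogeneous_part_majorant => // i; rewrite !mxE.
have [_ uv] := cvg_series_cauchy_product (nrm c) (nrm (inv_coef c)) U V.
have := abs_cvg_series V; set D := limn _ => vD.
have := uv _ _ u vD.
rewrite (_ : cauchy_product _ _ = (fun d => (d == 0%N)%:R)); last first.
  by apply/funext => d; rewrite cauchy_product_inv_coef.
move/(cvg_unique (@Rhausdorff R) series_dirac0) => fD.
suff -> : (f x)^-1 = D by exact: vD.
have fx0 : f x != 0.
  by apply/eqP => fx0; move: fD; rewrite fx0 mul0r => /eqP; rewrite oner_eq0.
by rewrite -[LHS]mulr1 fD mulKf.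
Qed.

End PowerSeries.

(** * Differentiability classes *)

Lemma near_eq_differentiable (R : realType) (V W : normedModType R)
    (f g : V -> W) (x : V) :
  (\near x, f x = g x) -> differentiable f x -> differentiable g x.
Proof.
move=> fg dfx; have [dfc /eqaddoP dfE] := (diff_locallyP x f).1 dfx.
have fgx : f x = g x by exact: nbhs_singleton fg.
have gE : g \o shift x = cst (g x) + 'd f x +o_ 0 id.
  apply/eqaddoP => _/posnumP[eps].
  have fg0 : \forall h \near (0 : V), f (h + x) = g (h + x).
    by move: fg; rewrite (near_shift 0) subr0.
  near=> h.
  have fgh : f (h + x) = g (h + x) by near: h; exact: fg0.
  suff : `|(f \o shift x - (cst (f x) + 'd f x)) h| <= eps%:num * `|h|.
    by rewrite !fctE /= fgh fgx.
  by near: h; exact: dfE.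
by apply/diff_locallyP; rewrite (diff_unique dfc gE).
Unshelve. all: by end_near. Qed.

Section Ck.
Variables (R : realType) (V : normedModType R) (D : set V).
Hypothesis Dopen : open D.

Lemma near_open (P : V -> Prop) x : D x -> (forall y, D y -> P y) -> \near x, P x.
Proof. by move=> Dx DP; apply: filterS DP _; exact: open_nbhs_nbhs. Qed.

(** On an open set the germs of f and g agree at each point, hence so do all their
    iterated derivatives. *)
Lemma Ck_eq (W : normedModType R) k (f g : V -> W) :
  (forall x, D x -> f x = g x) -> Ck k D f -> Ck k D g.
Proof.
elim: k f g => [|k IH] f g fg /=.
  move=> cf x Dx; change (g y @[y --> x] --> g x); rewrite -(fg _ Dx).
  apply: cvg_trans (cf x Dx); apply: near_eq_cvg.
  exact: near_open Dx fg.
move=> [df Ckf]; split=> [x Dx|v].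
  by apply: near_eq_differentiable (df x Dx); exact: near_open Dx fg.
apply: IH (Ckf v) => x Dx; apply: near_eq_derive; exact: near_open Dx fg.
Qed.

Lemma CkW (W : normedModType R) k (f : V -> W) : Ck k.+1 D f -> Ck k D f.
Proof.
elim: k f => [|k IH] f [df Ckf] /=.
  by move=> x Dx; apply: differentiable_continuous; exact: df.
by split=> // v; exact: IH.
Qed.

Lemma Ck_cst (W : normedModType R) k (c : W) : Ck k D (fun=> c).
Proof.
elim: k c => [|k IH] c /=; first by move=> x _; exact: cst_continuous.
split=> [x _|v]; first exact: differentiable_cst.
by apply: (Ck_eq _ (IH 0)) => x _; rewrite derive_cst.
Qed.

Lemma Ck_add (W : normedModType R) k (f g : V -> W) :
  Ck k D f -> Ck k D g -> Ck k D (fun x => f x + g x).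
Proof.
elim: k f g => [|k IH] f g /=.
  by move=> cf cg x Dx; apply: continuousD; [exact: cf|exact: cg].
move=> [df Cf] [dg Cg]; split=> [x Dx|v].
  by apply: differentiableD; [exact: df|exact: dg].
apply: (Ck_eq _ (IH _ _ (Cf v) (Cg v))) => x Dx.
by rewrite -deriveD//; apply: diff_derivable; [exact: df|exact: dg].
Qed.

Lemma Ck_mul k (f g : V -> R) :
  Ck k D f -> Ck k D g -> Ck k D (fun x => f x * g x).
Proof.
elim: k f g => [|k IH] f g.
  by move=> cf cg x Dx; apply: continuousM; [exact: cf|exact: cg].
move=> Cf' Cg'; have Cf := CkW Cf'; have Cg := CkW Cg'.
case: Cf' => df Cdf; case: Cg' => dg Cdg; split=> [x Dx|v].
  by apply: differentiableM; [exact: df|exact: dg].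
apply: (Ck_eq _ (Ck_add (IH _ _ Cf (Cdg v)) (IH _ _ Cg (Cdf v)))) => x Dx.
rewrite (_ : (fun x => f x * g x) = f * g)// deriveM//; apply: diff_derivable.
  exact: df.
exact: dg.
Qed.

(** The derivative of 1/f is - f' (1/f)^2, so the induction on k needs only that
    1/f is one class less regular. *)
Lemma Ck_inv k (f : V -> R) : (forall x, D x -> f x != 0) ->
  Ck k D f -> Ck k D (fun x => (f x)^-1).
Proof.
move=> f0; elim: k => [|k IH].
  by move=> cf x Dx; apply: continuousV; [exact: f0|exact: cf].
move=> Cf'; have Cf := CkW Cf'; case: Cf' => df Cdf; split=> [x Dx|v].
  by apply: differentiableV; [exact: df|exact: f0].
apply: (Ck_eq _ (Ck_mul (Ck_cst k (-1 : R)) (Ck_mul (Cdf v) (Ck_mul (IH Cf) (IH Cf))))).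
move=> x Dx.
rewrite deriveV; last 2 first.
  exact: f0.
  by apply: diff_derivable; exact: df.
by rewrite -[RHS]/(- f x ^- 2 * 'D_v f x) mulN1r mulNr expr2 invfM mulrC.
Qed.

Lemma differentiable_mx p q (f : V -> 'M[R]_(p, q)) x :
  (forall i j, differentiable (fun x => f x i j) x) -> differentiable f x.
Proof.
move=> df.
rewrite (_ : f = \sum_(i < p) \sum_(j < q) (fun x => f x i j *: delta_mx i j)).
  apply: differentiable_sum => i; apply: differentiable_sum => j.
  exact: differentiableZl.
apply/funext => y; rewrite {1}(matrix_sum_delta (f y)) fct_sumE.
by apply: eq_bigr => i _; rewrite fct_sumE.
Qed.

Lemma differentiable_entry p q (f : V -> 'M[R]_(p, q)) x i j :
  differentiable f x -> differentiable (fun x => f x i j) x.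
Proof.
move=> df; apply: (@differentiable_comp _ _ _ _ f (fun M : 'M[R]_(p, q) => M i j)) => //.
exact: differentiable_coord.
Qed.

Lemma derive_entry p q (f : V -> 'M[R]_(p, q)) x v i j :
  differentiable f x -> ('D_v f x) i j = 'D_v (fun x => f x i j) x.
Proof. by move=> df; rewrite derive_mx ?mxE//; exact: diff_derivable. Qed.

Lemma continuous_mx p q (f : V -> 'M[R]_(p, q)) x :
  (forall i j, {for x, continuous (fun x => f x i j)}) -> {for x, continuous f}.
Proof.
move=> cf.
apply/cvg_ballP => e e0; near=> y; split=> //.
near: y; apply: filter_forall => i; apply: filter_forall => j.
have /cvg_ballP := cf i j; exact.
Unshelve. all: by end_near. Qed.

(** Reduces the regularity of matrix-valued functions to that of their entries, where
    products and inverses make sense. *)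
Lemma Ck_mxP k p q (f : V -> 'M[R]_(p, q)) :
  Ck k D f <-> forall i j, Ck k D (fun x => f x i j).
Proof.
elim: k f => [|k IH] f; split.
- move=> cf i j x Dx; have := cf x Dx => cfx.
  exact: (@continuous_comp _ _ _ f (fun M : 'M[R]_(p, q) => M i j) _ cfx
    (@coord_continuous _ _ _ i j _)).
- by move=> cf x Dx; apply: continuous_mx => i j; exact: cf.
- move=> [df Cf] i j; split=> [x Dx|v]; first exact/differentiable_entry/df.
  apply: Ck_eq ((IH _).1 (Cf v) i j) => x Dx.
  by rewrite derive_entry//; exact: df.
- move=> cf.
  have df x : D x -> differentiable f x.
    by move=> Dx; apply: differentiable_mx => i j; exact: (cf i j).1.
  split=> // v; apply/IH => i j; apply: Ck_eq ((cf i j).2 v) => x Dx.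
  by rewrite derive_entry//; exact: df.
Qed.

End Ck.

Section OfClass.
Variables (R : realType) (s : smoothness) (n : nat) (D : set 'cV[R]_n).
Hypothesis Dopen : open D.

Definition scalar_of_class (f : 'cV[R]_n -> R) : Prop :=
  (forall k, Ck k D f) /\
  (s = Comega -> forall a, D a -> has_power_series_at f a).

Lemma of_classP p q (f : 'cV[R]_n -> 'M[R]_(p, q)) :
  of_class s D f <-> forall i j, scalar_of_class (fun x => f x i j).
Proof.
split=> [[Cf Af] i j|cf].
  by split=> [k|sw a Da]; [exact: (Ck_mxP Dopen k f).1|exact: Af].
split=> [k|sw a Da i j]; first by apply/Ck_mxP => // i j; exact: (cf i j).1.
exact: (cf i j).2.
Qed.

Lemma scalar_of_class_cst c : scalar_of_class (fun=> c).
Proof.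
by split=> [k|_ a _]; [exact: Ck_cst|exact: has_power_series_cst].
Qed.

Lemma scalar_of_class_add f g : scalar_of_class f -> scalar_of_class g ->
  scalar_of_class (fun x => f x + g x).
Proof.
move=> [Cf Af] [Cg Ag]; split=> [k|sw a Da]; first exact: Ck_add.
by apply: has_power_series_add; [exact: Af|exact: Ag].
Qed.

Lemma scalar_of_class_mul f g : scalar_of_class f -> scalar_of_class g ->
  scalar_of_class (fun x => f x * g x).
Proof.
move=> [Cf Af] [Cg Ag]; split=> [k|sw a Da]; first exact: Ck_mul.
by apply: has_power_series_mul; [exact: Af|exact: Ag].
Qed.

Lemma scalar_of_class_inv f : (forall x, D x -> f x != 0) ->
  scalar_of_class f -> scalar_of_class (fun x => (f x)^-1).
Proof.
move=> f0 [Cf Af]; split=> [k|sw a Da]; first exact: Ck_inv.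
by apply: has_power_series_inv; [exact: f0|exact: Af].
Qed.

Lemma scalar_of_class_sum (I : Type) (r : seq I) (P : pred I) F :
  (forall i, scalar_of_class (F i)) ->
  scalar_of_class (fun x => \sum_(i <- r | P i) F i x).
Proof.
move=> cF; elim: r => [|i r IH].
  by under [X in scalar_of_class X]funext do rewrite big_nil; exact: scalar_of_class_cst.
under [X in scalar_of_class X]funext do rewrite big_cons.
by case: (P i) => //; exact: scalar_of_class_add.
Qed.

Lemma scalar_of_class_prod (I : Type) (r : seq I) (P : pred I) F :
  (forall i, scalar_of_class (F i)) ->
  scalar_of_class (fun x => \prod_(i <- r | P i) F i x).
Proof.
move=> cF; elim: r => [|i r IH].
  by under [X in scalar_of_class X]funext do rewrite big_nil; exact: scalar_of_class_cst.
under [X in scalar_of_class X]funext do rewrite big_cons.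
by case: (P i) => //; exact: scalar_of_class_mul.
Qed.

Lemma scalar_of_class_eq f g : (forall x, D x -> f x = g x) ->
  scalar_of_class f -> scalar_of_class g.
Proof.
move=> fg [Cf Af]; split=> [k|sw a Da]; first exact: Ck_eq (Cf k).
have [c [r [r0 cr]]] := Af sw a Da.
have [e e0 De] : exists2 e, 0 < e & ball a e `<=` D.
  by have /nbhs_ballP[e] : nbhs a D by [exact: open_nbhs_nbhs]; exists e.
exists c, (Num.min r e); split=> [|x ax]; first by rewrite lt_min r0.
rewrite -fg; first by apply: cr; apply: le_ball ax; rewrite ge_min lexx.
by apply: De; apply: le_ball ax; rewrite ge_min lexx orbT.
Qed.

Lemma of_class_eq p q (f g : 'cV[R]_n -> 'M[R]_(p, q)) :
  (forall x, D x -> f x = g x) -> of_class s D f -> of_class s D g.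
Proof.
move=> fg /of_classP cf; apply/of_classP => i j.
by apply: scalar_of_class_eq (cf i j) => x Dx; rewrite fg.
Qed.

Lemma of_class_cst p q (A : 'M[R]_(p, q)) : of_class s D (fun=> A).
Proof. by apply/of_classP => i j; exact: scalar_of_class_cst. Qed.

Lemma of_class_mulmx p q r (f : 'cV[R]_n -> 'M[R]_(p, q)) (g : 'cV[R]_n -> 'M[R]_(q, r)) :
  of_class s D f -> of_class s D g -> of_class s D (fun x => f x *m g x).
Proof.
move=> /of_classP cf /of_classP cg; apply/of_classP => i j.
under [X in scalar_of_class X]funext do rewrite mxE.
by apply: scalar_of_class_sum => k; exact: scalar_of_class_mul.
Qed.

Lemma of_class_scale p q (f : 'cV[R]_n -> R) (g : 'cV[R]_n -> 'M[R]_(p, q)) :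
  scalar_of_class f -> of_class s D g -> of_class s D (fun x => f x *: g x).
Proof.
move=> cf /of_classP cg; apply/of_classP => i j.
under [X in scalar_of_class X]funext do rewrite mxE.
exact: scalar_of_class_mul.
Qed.

Lemma of_class_sum p q (I : Type) (r : seq I) (P : pred I)
    (F : I -> 'cV[R]_n -> 'M[R]_(p, q)) :
  (forall i, of_class s D (F i)) ->
  of_class s D (fun x => \sum_(i <- r | P i) F i x).
Proof.
move=> cF; apply/of_classP => i j.
under [X in scalar_of_class X]funext do rewrite summxE.
by apply: scalar_of_class_sum => k; have /of_classP := cF k; apply.
Qed.

Lemma of_class_det m (f : 'cV[R]_n -> 'M[R]_m) :
  of_class s D f -> scalar_of_class (fun x => \det (f x)).
Proof.
move=> /of_classP cf; apply: scalar_of_class_sum => p.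
apply: scalar_of_class_mul; first exact: scalar_of_class_cst.
by apply: scalar_of_class_prod => i; exact: cf.
Qed.

(** By Cramer's rule the entries of the inverse are polynomials in the entries of
    the matrix divided by its determinant. *)
Lemma of_class_invmx m (f : 'cV[R]_n -> 'M[R]_m) :
  (forall x, D x -> f x \in unitmx) ->
  of_class s D f -> of_class s D (fun x => invmx (f x)).
Proof.
move=> fU cf.
apply: (@of_class_eq _ _ (fun x => (\det (f x))^-1 *: \adj (f x))).
  by move=> x Dx; rewrite /invmx fU.
apply: of_class_scale.
  apply: scalar_of_class_inv; last exact: of_class_det.
  by move=> x /fU; rewrite unitmxE unitfE.
apply/of_classP => i j.
under [X in scalar_of_class X]funext do rewrite mxE.
apply: scalar_of_class_mul; first exact: scalar_of_class_cst.
apply: of_class_det; apply/of_classP => k l.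
under [X in scalar_of_class X]funext do rewrite !mxE.
by have /of_classP := cf; apply.
Qed.

Lemma of_class_differentiable p q (f : 'cV[R]_n -> 'M[R]_(p, q)) x :
  of_class s D f -> D x -> differentiable f x.
Proof. by move=> [/(_ 1%N)[df _] _]; exact: df. Qed.

End OfClass.

Lemma of_classS (R : realType) (s : smoothness) (n p q : nat) (D D' : set 'cV[R]_n)
    (f : 'cV[R]_n -> 'M[R]_(p, q)) :
  D' `<=` D -> of_class s D f -> of_class s D' f.
Proof.
move=> DD' [Cf Af]; split=> [k|sw a D'a]; last exact/Af/DD'.
suff CkS (W : normedModType R) k' (g : 'cV[R]_n -> W) : Ck k' D g -> Ck k' D' g by exact: CkS.
elim: k' g => [|k' IH] g /=; first by move=> cg x /DD'; exact: cg.
by move=> [dg Cg]; split=> [x /DD'|v]; [exact: dg|exact: IH].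
Qed.

(** * Cyclic vectors and Jordan forms *)

Section PolyEval.
Variables (F : fieldType).

(** Unlike [horner_mx], defined for matrices of every size, including sizes such
    as sums of block sizes that are not syntactically successors. *)
Definition mxeval d (A : 'M[F]_d) (p : {poly F}) : 'M[F]_d :=
  \sum_(k < size p) p`_k *: A ^+ k.

Lemma mxeval_widen d (A : 'M[F]_d) (p : {poly F}) N : (size p <= N)%N ->
  mxeval A p = \sum_(k < N) p`_k *: A ^+ k.
Proof.
move=> pN; rewrite /mxeval (big_ord_widen N (fun k => p`_k *: A ^+ k))// big_mkcond.
apply: eq_bigr => k _; case: ltnP => // /(nth_default 0) ->.
by rewrite scale0r.
Qed.

Lemma mxevalE d (A : 'M[F]_d.+1) p : mxeval A p = horner_mx A p.
Proof.
rewrite /horner_mx /horner_morph (@horner_coef_wide _ (size p)) ?size_poly//.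
by apply: eq_bigr => k _; rewrite coef_map /= -[RHS]/(_%:M *m _) mul_scalar_mx.
Qed.

Lemma mxevalM d (A : 'M[F]_d) p q : mxeval A (p * q) = mxeval A p *m mxeval A q.
Proof.
case: d A => [|d] A; first by apply/matrixP => -[].
by rewrite !mxevalE rmorphM.
Qed.

Lemma mxeval_XsubC d (A : 'M[F]_d) a : mxeval A ('X - a%:P) = A - a%:M.
Proof.
case: d A => [|d] A; first by apply/matrixP => -[].
by rewrite !mxevalE rmorphB /= horner_mx_X horner_mx_C.
Qed.

Lemma mxeval1 d (A : 'M[F]_d) : mxeval A 1 = 1%:M.
Proof.
case: d A => [|d] A; first by apply/matrixP => -[].
by rewrite !mxevalE rmorph1.
Qed.

Lemma mxeval_comm d (A : 'M[F]_d) p q :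
  mxeval A p *m mxeval A q = mxeval A q *m mxeval A p.
Proof. by rewrite -!mxevalM mulrC. Qed.

Lemma mxeval_eigen d (A : 'M[F]_d) (u : 'cV_d) a p : A *m u = a *: u ->
  mxeval A p *m u = p.[a] *: u.
Proof.
move=> Au; rewrite mulmx_suml horner_coef scaler_suml; apply: eq_bigr => k _.
rewrite -scalemxAl -scalerA; congr (_ *: _).
elim: (k : nat) => [|j IH]; first by rewrite !expr0 scale1r mul1mx.
by rewrite !exprSr -mulmxA Au -scalemxAr IH scalerA mulrC.
Qed.

Lemma mxeval_conj d e (A : 'M[F]_d) (B : 'M[F]_e) (P : 'M[F]_(d, e)) (Q : 'M[F]_(e, d)) p :
  A = P *m B *m Q -> Q *m P = 1%:M -> P *m Q = 1%:M ->
  mxeval A p = P *m mxeval B p *m Q.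
Proof.
move=> -> QP PQ; rewrite mulmx_sumr mulmx_suml; apply: eq_bigr => k _.
rewrite -scalemxAr -scalemxAl; congr (_ *: _).
elim: (k : nat) => [|j IH]; first by rewrite !expr0 mulmx1 PQ.
rewrite !exprSr -[LHS]/(_ *m _) IH.
by rewrite -!mulmxA (mulmxA Q P) QP mul1mx.
Qed.

Lemma mxeval_vec d (A : 'M[F]_d) (v : 'cV_d) (p : {poly F}) N : (size p <= N)%N ->
  mxeval A p *m v = \sum_(k < N) p`_k *: (A ^+ k *m v).
Proof.
move=> pN; rewrite (mxeval_widen _ pN) mulmx_suml.
by apply: eq_bigr => k _; rewrite scalemxAl.
Qed.

End PolyEval.

Section JordanBlock.
Variables (F : fieldType) (a : F) (m : nat).
Let J : 'M[F]_m := jordan_block a m.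

(** The j-th basis vector of the Jordan chain, numbered from 1; number 0 stands
    for the zero vector, at which the chain ends. *)
Definition jordan_vec (j : nat) : 'cV[F]_m := \col_i (i.+1 == j :> nat)%:R.

Lemma jordan_vec_shift (j : nat) : (j < m)%N ->
  (J - a%:M) *m jordan_vec j.+1 = jordan_vec j.
Proof.
move=> jm; apply/colP => i; rewrite !mxE (bigD1 (Ordinal jm))//= big1 ?addr0.
  by rewrite !mxE eqxx mulr1 addrAC subrr add0r.
by move=> l lj; rewrite [jordan_vec _ _ _]mxE eqSS (negPf (lj : l != j :> nat)) mulr0.
Qed.

Lemma jordan_vec0 : jordan_vec 0 = 0.
Proof. by apply/colP => i; rewrite !mxE. Qed.

Lemma jordan_vec_neq0 j : (0 < j <= m)%N -> jordan_vec j != 0.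
Proof.
case: j => //= j jm; apply/eqP => /colP/(_ (Ordinal jm)).
by rewrite !mxE eqxx => /eqP; rewrite oner_eq0.
Qed.

Lemma mxeval_XsubC_jordan_vec k j : (k + j <= m)%N ->
  mxeval J (('X - a%:P) ^+ k) *m jordan_vec (k + j) = jordan_vec j.
Proof.
elim: k => [|k IH] kj; first by rewrite expr0 mxeval1 mul1mx.
rewrite exprSr mxevalM mxeval_XsubC -mulmxA addSn jordan_vec_shift//.
by rewrite IH// ltnW.
Qed.

(** The nilpotent part moves the chain down by one.  By induction on j, p is
    divisible by (X - a)^j, and the remaining factor q of p acts on the last
    vector of the chain, an eigenvector, as the scalar q(a). *)
Lemma jordan_vec_annihilator p j : (j <= m)%N ->
  mxeval J p *m jordan_vec j = 0 <-> (('X - a%:P) ^+ j %| p)%R.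
Proof.
move=> jm; split; last first.
  move=> /dvdpP[q ->]; rewrite mxevalM -mulmxA -[X in jordan_vec X]addn0.
  by rewrite mxeval_XsubC_jordan_vec ?addn0// jordan_vec0 mulmx0.
elim: j jm => [|j IH] jm pj; first by rewrite expr0 dvd1p.
have /dvdpP[q pq] : (('X - a%:P) ^+ j %| p)%R.
  apply: IH; first exact: ltnW.
  rewrite -(jordan_vec_shift jm) mulmxA -mxeval_XsubC mxeval_comm -mulmxA pj.
  by rewrite mulmx0.
have J1 : J *m jordan_vec 1 = a *: jordan_vec 1.
  apply/eqP; rewrite -subr_eq0 -mul_scalar_mx -mulmxBl jordan_vec_shift ?jordan_vec0//.
  exact: leq_trans jm.
move: pj; rewrite pq mxevalM -mulmxA -(addn1 j) mxeval_XsubC_jordan_vec ?addn1//.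
rewrite (mxeval_eigen _ J1) => /eqP; rewrite scaler_eq0.
rewrite (negPf (jordan_vec_neq0 _)) ?orbF; last exact: leq_trans jm.
move=> qa; rewrite exprS dvdp_mul2r ?expf_neq0 ?polyXsubC_eq0//.
by rewrite dvdp_XsubCl.
Qed.

End JordanBlock.

Section Jordan.
Variables (F : fieldType) (k : nat) (a : 'I_k -> F) (m : 'I_k -> nat).
Hypothesis a_inj : injective a.
Let J := \mxdiag_i jordan_block (a i) (m i).

Definition jordan_poly : {poly F} := \prod_i ('X - (a i)%:P) ^+ m i.

(** The sum of the tops of the Jordan chains of all blocks, a cyclic vector when the
    eigenvalues are distinct. *)
Definition jordan_cyclic : 'cV[F]_(\sum_i m i) := \mxcol_i jordan_vec F (m i) (m i).

Lemma size_jordan_poly : size jordan_poly = (\sum_i m i).+1.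
Proof.
rewrite /jordan_poly; elim: (index_enum _) => [|i r IH].
  by rewrite !big_nil size_poly1.
rewrite !big_cons size_mul; last 2 first.
- by rewrite expf_neq0 ?polyXsubC_eq0.
- by rewrite -size_poly_gt0 IH.
by rewrite IH size_exp_XsubC addSn /= addnS.
Qed.

(** The factors are pairwise coprime because the eigenvalues are distinct. *)
Lemma dvdp_jordan_poly p :
  (jordan_poly %| p) <-> (forall i, ('X - (a i)%:P) ^+ m i %| p).
Proof.
split=> [jp i|ap]; first by apply: dvdp_trans jp; rewrite /jordan_poly (bigD1 i)//= dvdp_mulr.
rewrite /jordan_poly; have := index_enum_uniq 'I_k.
elim: (index_enum _) => [|i r IH]; first by rewrite big_nil dvd1p.
move=> /= /andP[ir ur]; rewrite big_cons Gauss_dvdp ?ap ?IH//.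
apply: coprimep_expl; elim: r ir {IH ur} => [|j r IH]; first by rewrite big_nil coprimep1.
rewrite inE negb_or big_cons => /andP[ij ir]; rewrite coprimepMr IH// andbT.
apply: coprimep_expr; rewrite coprimep_XsubC2//.
by rewrite subr_eq0; apply: contra ij => /eqP/a_inj->.
Qed.

Lemma mxeval_jordan_cyclic p :
  mxeval J p *m jordan_cyclic =
  \mxcol_i (mxeval (jordan_block (a i) (m i)) p *m jordan_vec F (m i) (m i)).
Proof.
have JX j : J ^+ j *m jordan_cyclic =
    \mxcol_i (jordan_block (a i) (m i) ^+ j *m jordan_vec F (m i) (m i)).
  elim: j => [|j IH].
    by rewrite expr0 mul1mx; apply: eq_mxcol => i; rewrite expr0 mul1mx.
  rewrite exprS -[LHS]mulmxA IH mul_mxdiag_mxcol; apply: eq_mxcol => i.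
  by rewrite exprS mulmxA.
rewrite mulmx_suml.
transitivity (\sum_(j < size p) \mxcol_i ((p`_j)%:M *m
    (jordan_block (a i) (m i) ^+ j *m jordan_vec F (m i) (m i)))).
  by apply: eq_bigr => j _; rewrite -scalemxAl JX -mul_scalar_mx -mxdiagZ mul_mxdiag_mxcol.
rewrite -mxcol_sum; apply: eq_mxcol => i; rewrite mulmx_suml.
by apply: eq_bigr => j _; rewrite mul_scalar_mx scalemxAl.
Qed.

(** Block by block the annihilator is generated by (X - a_i)^(m_i), and these
    polynomials are coprime.  Hence the annihilator of this vector, and with it the
    minimal polynomial of the matrix, has the full degree. *)
Lemma jordan_cyclic_annihilator p :
  mxeval J p *m jordan_cyclic = 0 <-> jordan_poly %| p.
Proof.
rewrite mxeval_jordan_cyclic dvdp_jordan_poly -(@mxcol0 _ _ m 1).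
split=> [/eq_mxcolP h i|h].
  exact/(jordan_vec_annihilator _ _ (leqnn _))/h.
by apply: eq_mxcol => i; exact/(jordan_vec_annihilator _ _ (leqnn _)).
Qed.

End Jordan.

Section Krylov.
Variables (F : fieldType).

Definition krylov d (A : 'M[F]_d) (v : 'cV[F]_d) N : 'M[F]_(d, N) :=
  \matrix_(i, j) (A ^+ j *m v) i 0.

Lemma krylov_mul d (A : 'M[F]_d) v N (c : 'cV_N) :
  krylov A v N *m c = \sum_j c j 0 *: (A ^+ j *m v).
Proof.
apply/colP => i; rewrite !mxE summxE; apply: eq_bigr => j _.
by rewrite !mxE mulrC.
Qed.

Lemma mul_krylov d e (B : 'M[F]_(e, d)) (A : 'M[F]_d) v N :
  B *m krylov A v N = \matrix_(i, j) (B *m (A ^+ j *m v)) i 0.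
Proof.
apply/matrixP => i j; rewrite !mxE; apply: eq_bigr => l _.
by rewrite !mxE.
Qed.

Lemma krylov_mxeval d (A : 'M[F]_d) v N (p : {poly F}) : (size p <= N)%N ->
  mxeval A p *m v = krylov A v N *m (\col_j p`_j).
Proof.
move=> pN; rewrite krylov_mul (mxeval_vec _ _ pN).
by apply: eq_bigr => j _; rewrite mxE.
Qed.

Lemma colP_poly N (c : 'cV[F]_N) :
  exists2 q : {poly F}, (size q <= N)%N & c = \col_j q`_j.
Proof.
exists (rVpoly c^T); first exact: size_poly.
by apply/colP => j; rewrite mxE coef_rVpoly_ord mxE.
Qed.

Lemma row_free_trP m N (K : 'M[F]_(m, N)) :
  (forall c : 'cV_N, K *m c = 0 -> c = 0) <-> row_free K^T.
Proof.
split=> [K0|Kf c Kc].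
  apply: inj_row_free => v vK; apply: (can_inj trmxK); rewrite trmx0; apply: K0.
  by apply: (can_inj trmxK); rewrite trmx_mul trmxK trmx0.
apply: (can_inj trmxK); rewrite trmx0; apply: (row_free_inj Kf).
by rewrite mul0mx -trmx_mul Kc trmx0.
Qed.

Lemma injective_square d N (K : 'M[F]_(d, N)) : d = N ->
  (forall c : 'cV_N, K *m c = 0 -> c = 0) ->
  exists K' : 'M[F]_(N, d), K *m K' = 1%:M /\ K' *m K = 1%:M.
Proof.
move=> dN; subst N => /row_free_trP; rewrite row_free_unit unitmx_tr => Ku.
by exists (invmx K); rewrite mulmxV ?mulVmx.
Qed.

(** The matrix of multiplication by X in the basis 1, X, ..., X^(N-1) of the
    quotient by the monic polynomial p of degree N. *)
Definition companion N (p : {poly F}) : 'M[F]_N :=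
  \matrix_(i, j) (if (j.+1 < N)%N then (i == j.+1 :> nat)%:R else - p`_i).

(** In the basis v, A v, ..., A^(N-1) v the operator A is the companion matrix of any
    monic polynomial of degree N annihilating v. *)
Lemma krylov_companion d (A : 'M[F]_d) v N (p : {poly F}) :
  p \is monic -> size p = N.+1 -> mxeval A p *m v = 0 ->
  A *m krylov A v N = krylov A v N *m companion N p.
Proof.
move=> /monicP pm sp pv; rewrite mul_krylov; apply/matrixP => i j.
rewrite [LHS]mxE [RHS]mxE mulmxA -[A *m _]exprS.
under [RHS]eq_bigr do rewrite [krylov _ _ _ _ _]mxE [companion _ _ _ _]mxE.
case: ltnP => jN.
  rewrite (bigD1 (Ordinal jN))//= eqxx mulr1 big1 ?addr0// => l lj.
  by rewrite (negPf (lj : l != j.+1 :> nat)) mulr0.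
have jE : j.+1 = N by apply/eqP; rewrite eqn_leq jN ltn_ord.
have /colP/(_ i) := pv; rewrite (@mxeval_vec _ _ _ _ _ N.+1) ?sp// big_ord_recr /=.
have -> : p`_N = 1 by rewrite -pm lead_coefE sp.
rewrite scale1r jE mxE summxE [RHS]mxE => /eqP; rewrite addrC addr_eq0 => /eqP ->.
rewrite -sumrN; apply: eq_bigr => l _.
by rewrite !mxE mulrN mulrC.
Qed.

End Krylov.

(** Let p be the characteristic polynomial of A.  Both A, with its cyclic vector,
    and the Jordan matrix with characteristic polynomial p and one block per root,
    with [jordan_cyclic], are conjugate to the companion matrix of p; hence they are
    conjugate to each other. *)
Lemma exists_jordan_form (F : closedFieldType) n (A : 'M[F]_n) (v : 'cV[F]_n) :
  (forall c : 'cV_n, krylov A v n *m c = 0 -> c = 0) ->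
  exists (k : nat) (a : 'I_k -> F) (m : 'I_k -> nat)
    (P : 'M[F]_(n, \sum_i m i)) (Q : 'M[F]_(\sum_i m i, n)),
  [/\ injective a, forall i, (0 < m i)%N, P *m Q = 1%:M, Q *m P = 1%:M
    & A = P *m (\mxdiag_i jordan_block (a i) (m i)) *m Q].
Proof.
move=> Kfree.
have pm := char_poly_monic A; have sp := size_char_poly A.
have pA : mxeval A (char_poly A) = 0.
  case: n A {v Kfree pm sp} => [|n] A; first by apply/matrixP => -[].
  by rewrite mxevalE Cayley_Hamilton.
set p := char_poly A in pm sp pA.
have [r pr] := closed_field_poly_normal p.
rewrite (monicP pm) scale1r in pr.
pose u := undup r.
pose k := size u; pose a (i : 'I_k) := u`_i; pose m (i : 'I_k) := count_mem (a i) r.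
have a_inj : injective a.
  move=> i j /eqP; rewrite /a nth_uniq ?undup_uniq// => /eqP; exact: val_inj.
have pE : p = jordan_poly a m.
  rewrite pr /jordan_poly -big_undup_iterop_count (big_nth 0) big_mkord.
  by apply: eq_bigr => i _.
have mn : (\sum_i m i)%N = n by apply: succn_inj; rewrite -(size_jordan_poly a) -pE.
pose J := \mxdiag_i jordan_block (a i) (m i).
pose w := jordan_cyclic F m.
have Jfree (c : 'cV_n) : krylov J w n *m c = 0 -> c = 0.
  have [q sq ->] := colP_poly c.
  rewrite -(krylov_mxeval _ _ sq) => /(jordan_cyclic_annihilator _ a_inj).
  rewrite -pE => /dvdp_leq; case: eqVneq => [-> _|q0 /(_ isT)].
    by apply/colP => j; rewrite !mxE coef0.
  by rewrite sp ltnNge sq.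
have [K' [KK' K'K]] := injective_square erefl Kfree.
have [J' [JJ' J'J]] := injective_square mn Jfree.
exists k, a, m, (krylov A v n *m J'), (krylov J w n *m K').
split=> // [i|||].
- by rewrite /m -has_count has_pred1 -mem_undup mem_nth.
- by rewrite mulmxA -(mulmxA _ J') J'J mulmx1.
- by rewrite mulmxA -(mulmxA _ K') K'K mulmx1.
have AK : A *m krylov A v n = krylov A v n *m companion n p.
  by apply: (krylov_companion pm sp); rewrite pA mul0mx.
have JK : J *m krylov J w n = krylov J w n *m companion n p.
  by apply: (krylov_companion pm sp); apply/(jordan_cyclic_annihilator _ a_inj); rewrite -pE.
rewrite -[LHS]mulmx1 -KK' mulmxA AK.
by rewrite -/J -!mulmxA (mulmxA J) JK (mulmxA J') (mulmxA J') J'J mul1mx.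
Qed.

(** A gl-regular matrix has a minimal polynomial of degree n: after conjugation to
    the Jordan form, an annihilating polynomial is divisible by [jordan_poly]. *)
Lemma gl_regular_annihilator (R : realType) n (A : 'M[R]_n) (p : {poly R}) :
  gl_regular A -> (size p <= n)%N -> mxeval A p = 0 -> p = 0.
Proof.
move=> [k [a [m [P [Q [a_inj m0 PQ QP AE]]]]]] pn pA.
have mn : (\sum_i m i)%N = n.
  by apply/eqP; rewrite eqn_leq (mulmx1_min PQ) (mulmx1_min QP).
pose q := map_poly (real_complex R) p.
have qA : mxeval (map_mx (real_complex R) A) q = 0.
  rewrite (@mxeval_widen _ _ _ _ (size p)) ?size_poly//.
  transitivity (map_mx (real_complex R) (mxeval A p)); last by rewrite pA map_mx0.
  rewrite /mxeval raddf_sum; apply: eq_bigr => j _.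
  rewrite coef_map /= map_mxZ; congr (_ *: _).
  elim: (j : nat) => [|i IH]; first by rewrite !expr0 map_mx1.
  by rewrite !exprS IH -[LHS]/(_ *m _) -map_mxM.
have qJ : mxeval (\mxdiag_i jordan_block (a i) (m i)) q = 0.
  have := mxeval_conj q AE QP PQ; rewrite qA => /(congr1 (fun X => Q *m X *m P)).
  by rewrite mulmx0 mul0mx !mulmxA QP mul1mx -mulmxA QP mulmx1 => <-.
have : jordan_poly a m %| q.
  by apply/(jordan_cyclic_annihilator _ a_inj); rewrite qJ mul0mx.
have q0 : (q == 0) = (p == 0) by rewrite map_poly_eq0.
case: (eqVneq p 0) => // pn0 /dvdp_leq; rewrite q0 => /(_ pn0).
by rewrite size_jordan_poly size_map_poly mn ltnNge pn.
Qed.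

(** Turns cyclicity into the invertibility of a matrix with analytic entries, so that
    coordinates in the basis e, L e, ..., L^(n-1) e depend analytically on the
    point. *)
Lemma cyclic_vectorP (R : realType) n (A : 'M[R]_n) (v : 'cV[R]_n) :
  cyclic_vector A v <-> krylov A v n \in unitmx.
Proof.
have iterE j : iter j (mulmx A) v = A ^+ j *m v.
  by elim: j => [|j IH]; rewrite ?mul1mx// iterS IH exprS mulmxA.
pose X := [tuple of map (fun k => iter k (mulmx A) v) (iota_tuple n 0)].
have XE (c : 'I_n -> R) : \sum_i c i *: X`_i = krylov A v n *m \col_i c i.
  rewrite krylov_mul; apply: eq_bigr => i _; rewrite mxE; congr (_ *: _).
  by rewrite (nth_map 0%N) ?size_iota//= nth_iota// iterE.
rewrite -unitmx_tr -row_free_unit -row_free_trP.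
split=> [/(@freeP _ _ _ X) fX c Kc|h].
  apply/colP => i; rewrite mxE.
  apply: (fX (fun i => c i 0)); rewrite XE -Kc; congr (_ *m _).
  by apply/colP => j; rewrite mxE.
apply/(@freeP _ _ _ X) => c; rewrite XE => /h/colP c0 i.
by have := c0 i; rewrite !mxE.
Qed.

Lemma cyclic_gl_regular (R : realType) n (A : 'M[R]_n) (v : 'cV[R]_n) :
  cyclic_vector A v -> gl_regular A.
Proof.
move/cyclic_vectorP => Ku; apply: (@exists_jordan_form _ _ _ (map_mx (real_complex R) v)).
have -> : krylov (map_mx (real_complex R) A) (map_mx (real_complex R) v) n =
    map_mx (real_complex R) (krylov A v n).
  apply/matrixP => i j; rewrite !mxE rmorph_sum /=; apply: eq_bigr => l _.
  rewrite mxE rmorphM /= ; congr (_ * _).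
  have -> : map_mx (real_complex R) A ^+ j = map_mx (real_complex R) (A ^+ j).
    elim: (j : nat) => [|t IH]; first by rewrite !expr0 map_mx1.
    by rewrite !exprS IH -[LHS]/(_ *m _) -map_mxM.
  by rewrite mxE.
move=> c Kc.
have Ku' : map_mx (real_complex R) (krylov A v n) \in unitmx by rewrite map_unitmx.
by rewrite -(mulKmx Ku' c) Kc mulmx0.
Qed.

(** * Bilinear products *)

Section Bilin.
Variables (R : realType) (n : nat).
Implicit Types (c : 'I_n -> 'M[R]_n) (u v w : 'cV[R]_n).

Lemma left_mult_bilin c u v : left_mult c u *m v = bilin c u v.
Proof. by rewrite mulmx_suml; apply: eq_bigr => k _; rewrite scalemxAl. Qed.

Lemma left_mult_delta c k : left_mult c (delta_mx k 0) = c k.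
Proof.
rewrite /left_mult (bigD1 k)//= big1 ?addr0 => [|l lk].
  by rewrite mxE !eqxx scale1r.
by rewrite mxE (negPf lk) scale0r.
Qed.

Lemma left_mult_linear c : linear (left_mult c).
Proof.
move=> b u v; rewrite scaler_sumr -big_split; apply: eq_bigr => k _.
by rewrite !mxE scalerDl scalerA.
Qed.

Lemma bilin_linearl c v : linear ((bilin c)^~ v).
Proof. by move=> b u w; rewrite -!left_mult_bilin left_mult_linear mulmxDl scalemxAl. Qed.

Lemma bilin_linearr c u : linear (bilin c u).
Proof. by move=> b v w; rewrite -!left_mult_bilin mulmxDr scalemxAr. Qed.

Lemma bilinDl c u v w : bilin c (u + v) w = bilin c u w + bilin c v w.
Proof. by have := bilin_linearl c w 1 u v; rewrite !scale1r. Qed.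

Lemma bilinDr c u v w : bilin c w (u + v) = bilin c w u + bilin c w v.
Proof. by have := bilin_linearr c w 1 u v; rewrite !scale1r. Qed.

Lemma bilin0l c v : bilin c 0 v = 0.
Proof. by rewrite /bilin big1// => k _; rewrite mxE scale0r. Qed.

Lemma bilin0r c v : bilin c v 0 = 0.
Proof. by rewrite /bilin big1// => k _; rewrite mulmx0 scaler0. Qed.

Lemma bilinZl c b u v : bilin c (b *: u) v = b *: bilin c u v.
Proof. by have := bilin_linearl c v b u 0; rewrite !addr0 bilin0l addr0. Qed.

Lemma bilinZr c b u v : bilin c u (b *: v) = b *: bilin c u v.
Proof. by have := bilin_linearr c u b v 0; rewrite !addr0 bilin0r addr0. Qed.

Lemma bilinNl c u v : bilin c (- u) v = - bilin c u v.
Proof. by rewrite -scaleN1r bilinZl scaleN1r. Qed.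

Lemma bilinNr c u v : bilin c u (- v) = - bilin c u v.
Proof. by rewrite -scaleN1r bilinZr scaleN1r. Qed.

End Bilin.

(** Identities between products of vectors become ring identities in a genuine
    commutative ring, where they can be checked by normalisation.  A homomorphism to
    a nonzero ring, rather than a ring structure on the vectors themselves, covers
    dimension 0 too. *)
Lemma algebra_embedding (R : realType) n (c : 'I_n -> 'M[R]_n) e :
  commutative (bilin c) -> associative (bilin c) -> left_id e (bilin c) ->
  exists (A : comNzRingType) (phi : {additive 'cV[R]_n -> A}),
    injective phi /\ {morph phi : u v / bilin c u v >-> u * v}.
Proof.
case: n c e => [|m] c e cC cA c1.
  exists int, (\0 : {additive 'cV[R]_0 -> int}).
  split=> [u v _|u v]; first by apply/colP => -[].
  by rewrite /= mulr0.
have e0 : e != 0.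
  apply/eqP => e0; have := c1 (const_mx 1).
  by rewrite e0 bilin0l => /colP/(_ 0); rewrite !mxE => /eqP; rewrite eq_sym oner_eq0.
pose A0 := GRing.Zmodule_isComNzRing.Build 'cV[R]_m.+1 cA cC c1
  (fun u v w => bilinDl c u v w) e0.
pose A : comNzRingType := HB.pack 'cV[R]_m.+1 A0.
exists A, (idfun : {additive A -> A}).
by split.
Qed.

Lemma linear_lincomb (R : realType) n p q (G : 'cV[R]_n -> 'M[R]_(p, q)) m
    (b : 'I_m -> R) (u : 'I_m -> 'cV[R]_n) :
  linear G -> G (\sum_j b j *: u j) = \sum_j b j *: G (u j).
Proof.
move=> Glin; pose g : {linear 'cV[R]_n -> 'M[R]_(p, q)} :=
  HB.pack G (GRing.isLinear.Build _ _ _ _ G Glin).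
by rewrite -[G]/(g : _ -> _) linear_sum; apply: eq_bigr => j _; rewrite linearZ.
Qed.

(** * The algebra of a cyclic operator *)

Section CyclicAlgebra.
Variables (R : realType) (n : nat).
Implicit Types (L B : 'M[R]_n) (e u v : 'cV[R]_n).

(** The polynomial in L that maps the cyclic vector e to u. *)
Definition cyc_mx L e u : 'M[R]_n :=
  \sum_(j < n) (invmx (krylov L e n) *m u) j 0 *: L ^+ j.

(** The product u o v = p(L) v, where u = p(L) e, transported from the algebra
    of polynomials in L along p(L) |-> p(L) e. *)
Definition cyc_prod L e : 'I_n -> 'M[R]_n := fun k => cyc_mx L e (delta_mx k 0).

Lemma cyc_mx_linear L e : linear (cyc_mx L e).
Proof.
move=> b u v; rewrite scaler_sumr -big_split; apply: eq_bigr => k _.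
by rewrite mulmxDr -scalemxAr !mxE scalerDl scalerA.
Qed.

Lemma left_mult_cyc L e u : left_mult (cyc_prod L e) u = cyc_mx L e u.
Proof.
have {2}-> : u = \sum_k u k 0 *: delta_mx k 0.
  by rewrite [LHS](matrix_sum_delta u); apply: eq_bigr => k _; rewrite big_ord1.
by rewrite (linear_lincomb _ _ (@cyc_mx_linear L e)).
Qed.

Lemma bilin_cyc L e u v : bilin (cyc_prod L e) u v = cyc_mx L e u *m v.
Proof. by rewrite -left_mult_bilin left_mult_cyc. Qed.

Lemma cyc_mx_comm L e u : cyc_mx L e u *m L = L *m cyc_mx L e u.
Proof.
rewrite mulmx_suml mulmx_sumr; apply: eq_bigr => j _.
by rewrite -scalemxAl -scalemxAr; congr (_ *: _); rewrite -[LHS]exprSr exprS.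
Qed.

Lemma comm_mxX L B k : B *m L = L *m B -> B *m L ^+ k = L ^+ k *m B.
Proof. by move=> BL; exact: (@commrX _ B L k BL). Qed.

Section Cyclic.
Variables (L : 'M[R]_n) (e : 'cV[R]_n).
Hypothesis Ku : krylov L e n \in unitmx.

Lemma cyc_mx_unit u : cyc_mx L e u *m e = u.
Proof.
rewrite -[RHS](mulKVmx Ku) krylov_mul mulmx_suml.
by apply: eq_bigr => j _; rewrite scalemxAl.
Qed.

(** If B commutes with L then B L^k e = L^k B e = 0, and the L^k e span. *)
Lemma comm_mx_eq0 B : B *m L = L *m B -> B *m e = 0 -> B = 0.
Proof.
move=> BL Be; rewrite -[B](mulmxK Ku) mul_krylov.
rewrite (_ : \matrix_(i, j) _ = 0) ?mul0mx//; apply/matrixP => i j.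
by rewrite [LHS]mxE mulmxA (comm_mxX _ BL) -mulmxA Be mulmx0 !mxE.
Qed.

(** This uniqueness is behind every law of the product: two operators commuting with L
    are compared at e only. *)
Lemma cyc_mx_unique B u : B *m L = L *m B -> B *m e = u -> B = cyc_mx L e u.
Proof.
move=> BL Be; apply/subr0_eq/comm_mx_eq0.
  by rewrite mulmxBl mulmxBr BL cyc_mx_comm.
by rewrite mulmxBl Be cyc_mx_unit subrr.
Qed.

Lemma cyc_mx_mulC u v : cyc_mx L e u *m cyc_mx L e v = cyc_mx L e v *m cyc_mx L e u.
Proof.
rewrite {1}/cyc_mx {2}/cyc_mx mulmx_suml mulmx_sumr; apply: eq_bigr => j _.
by rewrite -scalemxAl -scalemxAr (comm_mxX _ (cyc_mx_comm L e v)).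
Qed.

Lemma cyc_comm : commutative (bilin (cyc_prod L e)).
Proof.
move=> u v; rewrite !bilin_cyc -{1}(cyc_mx_unit v) mulmxA cyc_mx_mulC.
by rewrite -mulmxA cyc_mx_unit.
Qed.

Lemma cyc_assoc : associative (bilin (cyc_prod L e)).
Proof.
move=> u v w; rewrite !bilin_cyc mulmxA; congr (_ *m _).
apply: cyc_mx_unique; last by rewrite -mulmxA cyc_mx_unit.
by rewrite -mulmxA cyc_mx_comm mulmxA cyc_mx_comm mulmxA.
Qed.

Lemma cyc_left_id : left_id e (bilin (cyc_prod L e)).
Proof.
move=> u; rewrite bilin_cyc -(@cyc_mx_unique 1%:M) ?mul1mx//.
by rewrite mulmx1.
Qed.

Lemma cyc_mx_euler : cyc_mx L e (L *m e) = L.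
Proof. by rewrite -(@cyc_mx_unique L). Qed.

Lemma cyc_power i j :
  bilin (cyc_prod L e) (L ^+ i *m e) (L ^+ j *m e) = L ^+ (i + j) *m e.
Proof.
rewrite bilin_cyc -(@cyc_mx_unique (L ^+ i))//.
  by rewrite exprD mulmxA.
by rewrite -[LHS]exprSr exprS.
Qed.

(** The vectors L^k e span, so the tensor identities below need only be verified
    on them. *)
Lemma cyclic_ext (G : 'cV[R]_n -> 'cV[R]_n) : linear G ->
  (forall k, G (L ^+ k *m e) = 0) -> forall u, G u = 0.
Proof.
move=> Glin Ge u; rewrite -(mulKVmx Ku u) krylov_mul linear_lincomb// big1// => j _.
by rewrite Ge scaler0.
Qed.

End Cyclic.

(** The product depends on the pair (operator, cyclic vector) naturally under linear
    maps.  With Phi the differential of a change of coordinates this is the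
    transformation law of the product. *)
Lemma cyc_mx_intertwine (A B : 'M[R]_n) e e' (Phi : 'cV[R]_n -> 'cV[R]_n) u v :
  krylov A e n \in unitmx -> krylov B e' n \in unitmx -> linear Phi ->
  (forall w, B *m Phi w = Phi (A *m w)) -> e' = Phi e ->
  cyc_mx B e' (Phi u) *m Phi v = Phi (cyc_mx A e u *m v).
Proof.
move=> KA KB Plin PA Pe.
pose c := invmx (krylov A e n) *m u.
pose Q := \sum_(j < n) c j 0 *: B ^+ j.
have PX k w : Phi (A ^+ k *m w) = B ^+ k *m Phi w.
  elim: k => [|k IH]; first by rewrite !mul1mx.
  by rewrite !exprS -[A * _]/(_ *m _) -mulmxA -PA IH mulmxA.
have PQ w : Q *m Phi w = Phi (cyc_mx A e u *m w).
  transitivity (Phi (\sum_j c j 0 *: (A ^+ j *m w))).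
    rewrite linear_lincomb// mulmx_suml; apply: eq_bigr => j _.
    by rewrite -scalemxAl PX.
  by congr Phi; rewrite mulmx_suml; apply: eq_bigr => j _; rewrite scalemxAl.
rewrite -PQ; congr (_ *m _); apply/esym/cyc_mx_unique => //.
  rewrite mulmx_suml mulmx_sumr; apply: eq_bigr => j _.
  by rewrite -scalemxAl -scalemxAr -[_ *m B]exprSr exprS.
by rewrite Pe PQ cyc_mx_unit.
Qed.

End CyclicAlgebra.

(** * Derivatives of products, and tensoriality *)

(** The terms of the Hertling-Manin expression that contain a derivative of one of
    the four fields cancel.  Here XYZ stands for the derivative of Z along X o Y, ZX
    for the derivative of X along Z, and dZXY for the derivative along Z of the
    structure constants, applied to X and Y. *)
Lemma hm_identity (V : zmodType) (A : comNzRingType) (phi : {additive V -> A})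
    (m : V -> V -> V) (X Y Z T XYZ XYT ZTX ZTY ZX ZY TX TY YZ YT XZ XT
      dXYZT dZTXY dZXY dTXY dYZT dXZT : V) :
  injective phi -> {morph phi : u v / m u v >-> u * v} ->
  dXYZT + m XYZ T + m Z XYT - (dZTXY + m ZTX Y + m X ZTY)
  - m (XYZ - (dZXY + m ZX Y + m X ZY)) T
  - m Z (XYT - (dTXY + m TX Y + m X TY))
  - m X (dYZT + m YZ T + m Z YT - ZTY)
  + m (m X (YZ - ZY)) T + m (m X Z) (YT - TY)
  - m Y (dXZT + m XZ T + m Z XT - ZTX)
  + m (m Y (XZ - ZX)) T + m (m Y Z) (XT - TX) =
  dXYZT - dZTXY + m dZXY T + m Z dTXY - m X dYZT - m Y dXZT.
Proof.
move=> phi_inj phiM; apply: phi_inj.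
by rewrite !(raddfB, raddfD, phiM) /=; ring.
Qed.

Section Calculus.
Variables (R : realType) (n : nat).
Notation V := 'cV[R]_n.
Implicit Types (x v : V) (X Y Z T : V -> V) (a : V -> 'I_n -> 'M[R]_n).

Lemma derive_linear (p q : nat) (f : V -> 'M[R]_(p, q)) x :
  differentiable f x -> linear (fun v => 'D_v f x).
Proof. by move=> df b u v; rewrite !deriveE// linearP. Qed.

Lemma derive_scale p q (f : V -> R) (g : V -> 'M[R]_(p, q)) x v :
  differentiable f x -> differentiable g x ->
  differentiable (fun x => f x *: g x) x /\
  'D_v (fun x => f x *: g x) x = 'D_v f x *: g x + f x *: 'D_v g x.
Proof.
move=> df dg.
have E i j : (fun x => (f x *: g x) i j) = f * (fun x => g x i j).
  by apply/funext => y; rewrite mxE.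
have dfg : differentiable (fun x => f x *: g x) x.
  apply: differentiable_mx => i j; rewrite E.
  by apply: differentiableM => //; exact: differentiable_entry.
split=> //; apply/matrixP => i j; rewrite derive_entry// E deriveM; last 2 first.
- exact: diff_derivable.
- exact/diff_derivable/differentiable_entry.
rewrite !mxE derive_entry// addrC; congr (_ + _); exact: mulrC.
Qed.

Lemma derive_mulmx p q r (f : V -> 'M[R]_(p, q)) (g : V -> 'M[R]_(q, r)) x v :
  differentiable f x -> differentiable g x ->
  differentiable (fun x => f x *m g x) x /\
  'D_v (fun x => f x *m g x) x = 'D_v f x *m g x + f x *m 'D_v g x.
Proof.
move=> df dg.
have E i j : (fun x => (f x *m g x) i j) =
    \sum_k ((fun x => f x i k) * (fun x => g x k j)).
  by apply/funext => y; rewrite mxE fct_sumE.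
have dfk i k : differentiable (fun x => f x i k) x by exact: differentiable_entry.
have dgk k j : differentiable (fun x => g x k j) x by exact: differentiable_entry.
have dfg : differentiable (fun x => f x *m g x) x.
  apply: differentiable_mx => i j; rewrite E.
  by apply: differentiable_sum => k; exact: differentiableM.
split=> //; apply/matrixP => i j; rewrite derive_entry// E derive_sum; last first.
  by move=> k; apply/diff_derivable/differentiableM.
rewrite !mxE -big_split; apply: eq_bigr => k _.
rewrite deriveM; last 2 first.
- exact: diff_derivable.
- exact: diff_derivable.
by rewrite !derive_entry// addrC /=; congr (_ + _); rewrite mulrC.
Qed.

(** Again structure constants: bilin (dprod a x v) u w is the derivative along v of
    the product of u and w, held constant in the coordinates. *)
Definition dprod a x v : 'I_n -> 'M[R]_n := fun k => 'D_v (fun y => a y k) x.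

Lemma derive_left_mult a X x v :
  (forall k, differentiable (fun y => a y k) x) -> differentiable X x ->
  differentiable (fun y => left_mult (a y) (X y)) x /\
  'D_v (fun y => left_mult (a y) (X y)) x =
    left_mult (dprod a x v) (X x) + left_mult (a x) ('D_v X x).
Proof.
move=> da dX.
have E : (fun y => left_mult (a y) (X y)) = \sum_k (fun y => X y k 0 *: a y k).
  by apply/funext => y; rewrite fct_sumE.
have dXk k : differentiable (fun y => X y k 0) x by exact: differentiable_entry.
have dk k := derive_scale v (dXk k) (da k).
rewrite E; split; first by apply: differentiable_sum => k; exact: (dk k).1.
rewrite derive_sum => [|k]; last exact/diff_derivable/(dk k).1.
rewrite /left_mult -big_split; apply: eq_bigr => k _.
by rewrite (dk k).2 addrC derive_entry.
Qed.

Lemma derive_mul a X Y x v :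
  (forall k, differentiable (fun y => a y k) x) ->
  differentiable X x -> differentiable Y x ->
  differentiable (Defs.mul a X Y) x /\
  'D_v (Defs.mul a X Y) x = bilin (dprod a x v) (X x) (Y x) +
    bilin (a x) ('D_v X x) (Y x) + bilin (a x) (X x) ('D_v Y x).
Proof.
move=> da dX dY.
have -> : Defs.mul a X Y = fun y => left_mult (a y) (X y) *m Y y.
  by apply/funext => y; rewrite left_mult_bilin.
have [dl lE] := derive_left_mult v da dX.
have [dm mE] := derive_mulmx v dl dY.
by split=> //; rewrite mE lE mulmxDl !left_mult_bilin.
Qed.

Lemma lie_near X X' Y Y' x :
  (\near x, X x = X' x) -> (\near x, Y x = Y' x) -> lie X Y x = lie X' Y' x.
Proof.
move=> XX YY; rewrite /lie (near_eq_derive _ XX) (near_eq_derive _ YY).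
by rewrite (nbhs_singleton XX) (nbhs_singleton YY).
Qed.

Lemma lieC X Y x : lie X Y x = - lie Y X x.
Proof. by rewrite /lie opprB. Qed.

(** What remains of the Hertling-Manin expression after the derivatives of the
    fields cancel: an expression linear in the value of each field at x. *)
Definition hm_tensor a x (X Y Z T : V) : V :=
  let m := bilin (a x) in let d := fun v => bilin (dprod a x v) in
  d (m X Y) Z T - d (m Z T) X Y + m (d Z X Y) T + m Z (d T X Y)
  - m X (d Y Z T) - m Y (d X Z T).

Lemma hertling_maninE a e X Y Z T x :
  commutative (bilin (a x)) -> associative (bilin (a x)) ->
  left_id e (bilin (a x)) ->
  (forall k, differentiable (fun y => a y k) x) ->
  differentiable X x -> differentiable Y x ->
  differentiable Z x -> differentiable T x ->
  hertling_manin a X Y Z T x = hm_tensor a x (X x) (Y x) (Z x) (T x).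
Proof.
move=> aC aA a1 da dX dY dZ dT.
have [A [phi [phi_inj phiM]]] := algebra_embedding aC aA a1.
rewrite /hertling_manin /hm_tensor.
have DXY v := (derive_mul v da dX dY).2.
have DZT v := (derive_mul v da dZ dT).2.
have : Defs.mul a X Y x = bilin (a x) (X x) (Y x) by [].
have : Defs.mul a Z T x = bilin (a x) (Z x) (T x) by [].
move: DXY DZT; move: (Defs.mul a X Y) (Defs.mul a Z T) => P Q DP DQ Qx Px.
rewrite /Defs.mul /lie !DP !DQ !Px !Qx.
pose XY := bilin (a x) (X x) (Y x); pose ZT := bilin (a x) (Z x) (T x).
pose d v := bilin (dprod a x v).
exact (@hm_identity _ _ phi (bilin (a x)) (X x) (Y x) (Z x) (T x)
  ('D_XY Z x) ('D_XY T x) ('D_ZT X x) ('D_ZT Y x)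
  ('D_(Z x) X x) ('D_(Z x) Y x) ('D_(T x) X x) ('D_(T x) Y x)
  ('D_(Y x) Z x) ('D_(Y x) T x) ('D_(X x) Z x) ('D_(X x) T x)
  (d XY (Z x) (T x)) (d ZT (X x) (Y x)) (d (Z x) (X x) (Y x)) (d (T x) (X x) (Y x))
  (d (Y x) (Z x) (T x)) (d (X x) (Z x) (T x)) phi_inj phiM).
Qed.

Lemma dprod_linear a x w u : (forall k, differentiable (fun y => a y k) x) ->
  linear (fun v => bilin (dprod a x v) u w).
Proof.
move=> da b v v'; rewrite /bilin scaler_sumr -big_split; apply: eq_bigr => k _.
rewrite /dprod (derive_linear (da k)) mulmxDl scalerDr -scalemxAl.
by rewrite !scalerA mulrC.
Qed.

End Calculus.

Lemma near_refl (U : topologicalType) (T : Type) (X : U -> T) (x : U) :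
  nbhs x (fun y => X y = X y).
Proof. exact: filterE. Qed.

Section LinearMaps.
Variables (R : realType) (n : nat).
Notation V := 'cV[R]_n.

Lemma linear_id : linear (fun u : V => u). Proof. by []. Qed.

Lemma linear_add (f g : V -> V) : linear f -> linear g -> linear (fun u => f u + g u).
Proof. by move=> lf lg b u v; rewrite lf lg scalerDr addrACA. Qed.

Lemma linear_opp (f : V -> V) : linear f -> linear (fun u => - f u).
Proof. by move=> lf b u v; rewrite lf opprD scalerN. Qed.

Lemma linear_comp (f g : V -> V) : linear f -> linear g -> linear (fun u => f (g u)).
Proof. by move=> lf lg b u v; rewrite lg lf. Qed.

End LinearMaps.

Section EulerTensor.
Variables (R : realType) (n : nat).
Notation V := 'cV[R]_n.
Implicit Types (X Y E : V -> V) (a : V -> 'I_n -> 'M[R]_n).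

(** The condition on an Euler field E, as an expression that has to vanish. *)
Definition euler_defect a E X Y (x : V) : V :=
  let m := Defs.mul a in
  lie E (m X Y) x - m (lie E X) Y x - m X (lie E Y) x - m X Y x.

(** The same expression after the derivatives of X and Y cancel, bilinear in the
    values of X and Y at x. *)
Definition euler_tensor a E (x : V) (X Y : V) : V :=
  let m := bilin (a x) in
  bilin (dprod a x (E x)) X Y - 'D_(m X Y) E x + m ('D_X E x) Y + m X ('D_Y E x)
  - m X Y.

Lemma euler_identity (d XY D p q p' q' : V) :
  d + p + q - D - (p - p') - (q - q') - XY = d - D + p' + q' - XY.
Proof. by apply/colP => i; rewrite !mxE; ring. Qed.

Lemma euler_defectE a E X Y x :
  (forall k, differentiable (fun y => a y k) x) ->
  differentiable X x -> differentiable Y x ->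
  euler_defect a E X Y x = euler_tensor a E x (X x) (Y x).
Proof.
move=> da dX dY; have D v := (derive_mul v da dX dY).2.
have : Defs.mul a X Y x = bilin (a x) (X x) (Y x) by [].
rewrite /euler_defect; move: D; move: (Defs.mul a X Y) => P DP Px.
rewrite /Defs.mul /euler_tensor /lie !DP !Px.
rewrite !bilinDl !bilinDr !bilinNl !bilinNr.
exact: euler_identity.
Qed.

End EulerTensor.

(** * The fields L^k e and the Witt algebra *)

(** The fields w_k = L^k e satisfy w_p o w_q = w_(p+q) and the relations
    [w_i, w_j] = (j - i) w_(i+j-1) of the polynomial vector fields x^k d/dx.  With
    B i j in the place of the bracket, the axioms of an F-manifold become identities
    between integers. *)
Section WittIdentities.
Variables (R : realType) (n : nat).
Notation V := 'cV[R]_n.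
Variables (m : V -> V -> V) (w : nat -> V) (B : nat -> nat -> V).
Hypotheses (mZl : forall b u v, m (b *: u) v = b *: m u v)
  (mZr : forall b u v, m u (b *: v) = b *: m u v)
  (mw : forall p q, m (w p) (w q) = w (p + q))
  (Bw : forall i j, B i j = (j%:R - i%:R) *: w (i + j).-1).

(** The truncated predecessor is harmless: for p + q = 0 the coefficient vanishes. *)
Lemma scale_pred p q r :
  (q%:R - p%:R : R) *: w ((p + q).-1 + r) = (q%:R - p%:R) *: w (p + q + r).-1.
Proof.
case: (posnP (p + q)) => [/eqP|pq]; last by congr (_ *: w _); lia.
by rewrite addn_eq0 => /andP[/eqP-> /eqP->]; rewrite subrr !scale0r.
Qed.

Lemma bracket_mull p q r : m (B p q) (w r) = (q%:R - p%:R) *: w (p + q + r).-1.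
Proof. by rewrite Bw mZl mw scale_pred. Qed.

Lemma bracket_mulr p q r : m (w r) (B p q) = (q%:R - p%:R) *: w (p + q + r).-1.
Proof. by rewrite Bw mZr mw addnC scale_pred. Qed.

Lemma witt_hertling_manin i j k l :
  B (i + j) (k + l) - m (B (i + j) k) (w l) - m (w k) (B (i + j) l)
  - m (w i) (B j (k + l)) + m (m (w i) (B j k)) (w l) + m (m (w i) (w k)) (B j l)
  - m (w j) (B i (k + l)) + m (m (w j) (B i k)) (w l) + m (m (w j) (w k)) (B i l)
  = 0.
Proof.
(* every term is a multiple of w_(i+j+k+l-1) *)
have mB p q r s : m (m (w r) (B p q)) (w s) = (q%:R - p%:R) *: w (p + q + r + s).-1.
  rewrite Bw mZr mZl !mw (_ : r + _ + s = (p + q).-1 + (r + s))%N; last by lia.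
  by rewrite scale_pred addnA.
rewrite !mB !mw !bracket_mull !bracket_mulr Bw.
have -> : (i + j + (k + l) = i + j + k + l)%N by lia.
have -> : (i + j + l + k = i + j + k + l)%N by lia.
have -> : (j + (k + l) + i = i + j + k + l)%N by lia.
have -> : (j + k + i + l = i + j + k + l)%N by lia.
have -> : (j + l + (i + k) = i + j + k + l)%N by lia.
have -> : (i + (k + l) + j = i + j + k + l)%N by lia.
have -> : (i + k + j + l = i + j + k + l)%N by lia.
have -> : (i + l + (j + k) = i + j + k + l)%N by lia.
move: (w _) => W; apply/colP => t; rewrite !mxE !natrD; ring.
Qed.

Lemma witt_euler i j :
  B 1 (i + j) - m (B 1 i) (w j) - m (w i) (B 1 j) - w (i + j) = 0.
Proof.
rewrite bracket_mull bracket_mulr Bw.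
have -> : (1 + j + i = 1 + (i + j))%N by lia.
rewrite -(addnA 1%N i j) /=.
move: (w _) => W; apply/colP => t; rewrite !mxE !natrD; ring.
Qed.

End WittIdentities.

Section Witt.
Variables (R : realType) (n : nat).
Notation V := 'cV[R]_n.
Variables (L : V -> 'M[R]_n) (e : V -> V).

Definition power_field k : V -> V := fun x => L x ^+ k *m e x.
Notation pw := power_field.

Lemma power_field0 : pw 0 = e.
Proof. by apply/funext => x; rewrite /pw expr0 mul1mx. Qed.

Lemma power_fieldS k : pw k.+1 = app L (pw k).
Proof. by apply/funext => x; rewrite /pw /app exprS mulmxA. Qed.

Lemma differentiable_power_field k x :
  differentiable L x -> differentiable e x -> differentiable (pw k) x.
Proof.
move=> dL de; elim: k => [|k IH]; first by rewrite power_field0.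
rewrite power_fieldS; exact: (derive_mulmx 0 dL IH).1.
Qed.

(** L_e L = Id gives the case i = 0 by induction on j, antisymmetry gives j = 0, and the
    vanishing torsion on (L^i e, L^j e) gives [w_(i+1), w_(j+1)] from the brackets
    with smaller indices. *)
Lemma lie_power_field x :
  (forall i j, torsion L (pw i) (pw j) x = 0) ->
  (forall j, lie e (app L (pw j)) x - app L (lie e (pw j)) x = pw j x) ->
  forall i j, lie (pw i) (pw j) x = (j%:R - i%:R) *: pw (i + j).-1 x.
Proof.
move=> tors unity.
have LS k : L x *m pw k x = pw k.+1 x by rewrite power_fieldS.
have L0 p q : (q%:R - p%:R) *: (L x *m pw (p + q).-1 x) = (q%:R - p%:R) *: pw (p + q) x.
  by rewrite LS; have := scale_pred (fun k => pw k x) p q 1; rewrite !addn1.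
have L1 p q : (q%:R - p%:R) *: (L x *m (L x *m pw (p + q).-1 x)) =
    (q%:R - p%:R) *: pw (p + q).+1 x.
  by rewrite scalemxAr L0 -scalemxAr LS.
have base j : lie (pw 0) (pw j) x = (j%:R - 0%:R) *: pw (0 + j).-1 x.
  elim: j => [|j IH]; first by rewrite /lie !subrr scale0r.
  have := unity j; rewrite -power_fieldS -{1 2}power_field0 => /eqP.
  rewrite subr_eq => /eqP ->; rewrite /app IH -scalemxAr L0 add0n /=.
  by rewrite !subr0 -natr1 scalerDl scale1r addrC.
elim=> [//|i IHi]; elim=> [|j IHj].
  by rewrite lieC base -scaleNr opprB addn0.
have := tors i j; rewrite /torsion -!power_fieldS /app IHi IHj (IHi j.+1).
rewrite -!scalemxAr L1 !L0 !addnS !addSn /=.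
move: (lie _ _ x) (pw _ x) => B W h.
apply/colP => l; apply: subr0_eq; move/colP/(_ l): h; rewrite !mxE => <-.
by rewrite -!natr1; ring.
Qed.

Section CyclicProduct.
Variable D : set V.
Hypotheses (Dopen : open D).
Hypothesis Ku : forall x, D x -> krylov (L x) (e x) n \in unitmx.
Hypothesis witt : forall x, D x -> forall i j,
  lie (pw i) (pw j) x = (j%:R - i%:R) *: pw (i + j).-1 x.
Let a x := cyc_prod (L x) (e x).

Lemma mul_power_field i j x : D x -> Defs.mul a (pw i) (pw j) x = pw (i + j) x.
Proof. by move=> Dx; rewrite /Defs.mul cyc_power//; exact: Ku. Qed.

Lemma near_mul_power_field i j x : D x ->
  \near x, Defs.mul a (pw i) (pw j) x = pw (i + j) x.
Proof. by move=> Dx; apply: (near_open Dopen Dx) => y; exact: mul_power_field. Qed.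

Lemma hertling_manin_power_field i j k l x : D x ->
  hertling_manin a (pw i) (pw j) (pw k) (pw l) x = 0.
Proof.
move=> Dx; rewrite /hertling_manin.
move: (near_mul_power_field i j Dx) (near_mul_power_field k l Dx).
move: (Defs.mul a (pw i) (pw j)) (Defs.mul a (pw k) (pw l)) => P Q NP NQ.
rewrite /Defs.mul (lie_near NP NQ).
rewrite (lie_near NP (near_refl (pw k) x)) (lie_near NP (near_refl (pw l) x)).
rewrite (lie_near (near_refl (pw i) x) NQ) (lie_near (near_refl (pw j) x) NQ).
exact: (@witt_hertling_manin _ _ (bilin (a x)) (fun k => pw k x)
  (fun i j => lie (pw i) (pw j) x) (bilinZl (a x)) (bilinZr (a x))
  (fun p q => mul_power_field p q Dx) (witt Dx)).
Qed.

Lemma euler_defect_power_field i j x : D x ->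
  euler_defect a (pw 1) (pw i) (pw j) x = 0.
Proof.
move=> Dx; rewrite /euler_defect.
move: (near_mul_power_field i j Dx) (mul_power_field i j Dx).
move: (Defs.mul a (pw i) (pw j)) => P NP Px.
rewrite /Defs.mul Px (lie_near (near_refl (pw 1) x) NP).
exact: (@witt_euler _ _ (bilin (a x)) (fun k => pw k x)
  (fun i j => lie (pw i) (pw j) x) (bilinZl (a x)) (bilinZr (a x))
  (fun p q => mul_power_field p q Dx) (witt Dx)).
Qed.

Section AtPoint.
Variable x : V.
Hypotheses (Dx : D x) (dL : differentiable L x) (de : differentiable e x).
Hypothesis da : forall k, differentiable (fun y => a y k) x.

Let linl (f : V -> V) w : linear f -> linear (fun u => bilin (a x) (f u) w).
Proof. by move=> lf; exact: (linear_comp (bilin_linearl (a x) w) lf). Qed.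
Let linr (f : V -> V) w : linear f -> linear (fun u => bilin (a x) w (f u)).
Proof. by move=> lf; exact: (linear_comp (bilin_linearr (a x) w) lf). Qed.
Let lind (f : V -> V) w w' : linear f -> linear (fun u => bilin (dprod a x (f u)) w w').
Proof. by move=> lf; exact: (linear_comp (dprod_linear w' w da) lf). Qed.
Let lindl (f : V -> V) v w : linear f -> linear (fun u => bilin (dprod a x v) (f u) w).
Proof. by move=> lf; exact: (linear_comp (bilin_linearl (dprod a x v) w) lf). Qed.
Let lindr (f : V -> V) v w : linear f -> linear (fun u => bilin (dprod a x v) w (f u)).
Proof. by move=> lf; exact: (linear_comp (bilin_linearr (dprod a x v) w) lf). Qed.

Let dpw k : differentiable (pw k) x.
Proof. exact: differentiable_power_field. Qed.

Let lin_derive (f : V -> V) : linear f -> linear (fun u => 'D_(f u) (pw 1) x).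
Proof. by move=> lf; exact: (linear_comp (derive_linear (dpw 1)) lf). Qed.

Ltac multilinear := do ![apply: linear_add | apply: linear_opp | apply: linl
  | apply: linr | apply: lind | apply: lindl | apply: lindr | apply: lin_derive
  | apply: linear_id].

(** By linearity in each of the four arguments it suffices to treat the vectors
    L^k e, which are values of the fields w_k. *)
Lemma hm_tensor_eq0 u v w t : hm_tensor a x u v w t = 0.
Proof.
have aC := cyc_comm (Ku Dx); have aA := cyc_assoc (Ku Dx); have a1 := cyc_left_id (Ku Dx).
move: t; apply: (cyclic_ext (Ku Dx)) => [|l].
  by multilinear.
move: w; apply: (cyclic_ext (Ku Dx)) => [|k].
  by multilinear.
move: v; apply: (cyclic_ext (Ku Dx)) => [|j].
  by multilinear.
move: u; apply: (cyclic_ext (Ku Dx)) => [|i].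
  by multilinear.
rewrite -(hertling_manin_power_field i j k l Dx).
by rewrite (@hertling_maninE _ _ a _ _ _ _ _ _ aC aA a1 da).
Qed.

Lemma cyc_hertling_manin X Y Z T :
  differentiable X x -> differentiable Y x ->
  differentiable Z x -> differentiable T x -> hertling_manin a X Y Z T x = 0.
Proof.
move=> dX dY dZ dT.
have aC := cyc_comm (Ku Dx); have aA := cyc_assoc (Ku Dx); have a1 := cyc_left_id (Ku Dx).
by rewrite (@hertling_maninE _ _ a _ _ _ _ _ _ aC aA a1 da)// hm_tensor_eq0.
Qed.

Lemma cyc_euler X Y : differentiable X x -> differentiable Y x ->
  euler_defect a (app L e) X Y x = 0.
Proof.
move=> dX dY; rewrite -power_field0 -power_fieldS euler_defectE//.
move: (Y x); apply: (cyclic_ext (Ku Dx)) => [|j].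
  by multilinear.
move: (X x); apply: (cyclic_ext (Ku Dx)) => [|i].
  by multilinear.
by rewrite -(euler_defect_power_field i j Dx) euler_defectE.
Qed.

End AtPoint.
End CyclicProduct.
End Witt.

(** * From an F-manifold to a Nijenhuis operator *)

(** With L the multiplication by E, the torsion of L at (X, Y) is the
    Hertling-Manin expression at (E, X, E, Y), which is the first hypothesis, minus
    Y times the Euler condition for (E, X) plus X times the Euler condition for
    (E, Y).  Here EP and EQ are the brackets of E with P = E o X and Q = E o Y. *)
Lemma torsion_identity (V : zmodType) (A : comNzRingType) (phi : {additive V -> A})
    (m : V -> V -> V) (E X Y PQ EP EQ EX EY XY PY XQ : V) :
  injective phi -> {morph phi : u v / m u v >-> u * v} ->
  PQ - m (- EP) Y - m E PY - m E XQ + m (m E (- EX)) Y + m (m E E) XY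
    - m X EQ + m (m X 0) Y + m (m X E) EY = 0 ->
  EP - m 0 X - m E EX - m E X = 0 -> EQ - m 0 Y - m E EY - m E Y = 0 ->
  PQ + m E (m E XY) - m E PY - m E XQ = 0.
Proof.
move=> phi_inj phiM H1 H2 H3; apply: phi_inj.
have := congr1 phi H3; have := congr1 phi H2; have := congr1 phi H1.
rewrite !(raddfB, raddfD, raddfN, raddf0, phiM) /= => h1 h2 h3.
rewrite -[LHS]subr0 -[X in _ - X]h1.
transitivity (- (phi EP - 0 * phi X - phi E * phi EX - phi E * phi X) * phi Y
  + phi X * (phi EQ - 0 * phi Y - phi E * phi EY - phi E * phi Y)); first by ring.
by rewrite h2 h3 oppr0 mul0r mulr0 addr0.
Qed.

(** The Hertling-Manin identity at (e, e, E, X) says that the bracket with e is a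
    derivation of the product E o X, and the Euler condition at (e, e) says that
    [e, E] = e; hence [e, E o X] = X + E o [e, X].  Here s, p, r are the brackets of
    e with E, E o X and X. *)
Lemma unity_identity (R : realType) n (m : 'cV[R]_n -> 'cV[R]_n -> 'cV[R]_n)
    (e E X p r s : 'cV[R]_n) :
  left_id e m -> right_id e m -> (forall u v, m (- u) v = - m u v) ->
  p - m s X - m E r - m e p + m (m e s) X + m (m e E) r - m e p + m (m e s) X
    + m (m e E) r = 0 ->
  - s - m (- s) e - m e (- s) - e = 0 -> p - m E r = X.
Proof.
move=> m1 m1r mN; rewrite !m1 mN m1r => h1 h2.
have sE : s = e.
  by apply/colP => i; move/colP/(_ i): h2; rewrite !mxE; lra.
move: h1; rewrite sE !m1; move: (m E r) => q h.
by apply/colP => i; move/colP/(_ i): h; rewrite !mxE; lra.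
Qed.

Section FManifoldAtPoint.
Variables (R : realType) (n : nat).
Notation V := 'cV[R]_n.
Variables (a : V -> 'I_n -> 'M[R]_n) (e E : V -> V) (x : V).
Hypotheses (aC : commutative (bilin (a x))) (aA : associative (bilin (a x))).
Hypothesis a1 : \near x, left_id (e x) (bilin (a x)).

Lemma lie_unity_of_hm X :
  hertling_manin a e e E X x = 0 -> euler_defect a E e e x = 0 ->
  lie e (Defs.mul a E X) x - bilin (a x) (E x) (lie e X x) = X x.
Proof.
have a1x := nbhs_singleton a1.
have : \near x, Defs.mul a e e x = e x by apply: filterS a1 => y; exact.
rewrite /hertling_manin /euler_defect.
have : Defs.mul a e e x = e x by exact: a1x.
have : Defs.mul a E X x = bilin (a x) (E x) (X x) by [].
move: (Defs.mul a e e) (Defs.mul a E X) => P Q Qx Px NP.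
rewrite /Defs.mul (lie_near NP (near_refl Q x)) (lie_near NP (near_refl E x)).
rewrite (lie_near NP (near_refl X x)) (lie_near (near_refl E x) NP) Px.
rewrite (lieC E e) => hm eul.
apply: (unity_identity (m := bilin (a x)) a1x _ _ hm eul).
  by move=> v; rewrite aC a1x.
by move=> u v; rewrite bilinNl.
Qed.

Lemma torsion_of_hm X Y :
  hertling_manin a E X E Y x = 0 ->
  euler_defect a E E X x = 0 -> euler_defect a E E Y x = 0 ->
  lie (Defs.mul a E X) (Defs.mul a E Y) x
  + bilin (a x) (E x) (bilin (a x) (E x) (lie X Y x))
  - bilin (a x) (E x) (lie (Defs.mul a E X) Y x)
  - bilin (a x) (E x) (lie X (Defs.mul a E Y) x) = 0.
Proof.
have [A [phi [phi_inj phiM]]] := algebra_embedding aC aA (nbhs_singleton a1).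
rewrite /hertling_manin /euler_defect.
have : Defs.mul a E X x = bilin (a x) (E x) (X x) by [].
have : Defs.mul a E Y x = bilin (a x) (E x) (Y x) by [].
move: (Defs.mul a E X) (Defs.mul a E Y) => P Q Qx Px.
rewrite /Defs.mul Px Qx (lieC P E) (lieC X E).
have -> : lie E E x = 0 by rewrite /lie subrr.
move=> H1 H2 H3.
exact: (@torsion_identity _ _ phi (bilin (a x)) (E x) (X x) (Y x)
  (lie P Q x) (lie E P x) (lie E Q x) (lie E X x) (lie E Y x) (lie X Y x)
  (lie P Y x) (lie X Q x) phi_inj phiM H1 H2 H3).
Qed.

End FManifoldAtPoint.

Lemma mulmx_ext (F : fieldType) m n (A B : 'M[F]_(m, n)) :
  (forall v : 'cV_n, A *m v = B *m v) -> A = B.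
Proof.
move=> AB; apply/matrixP => i j; have := AB (delta_mx j 0).
by rewrite -!colE => /colP/(_ i); rewrite !mxE.
Qed.

(** If p(L) e = 0 then p(L) u = p(L) (e o u) = (p(L) e) o u = 0 for every u, because L
    is multiplication by E.  So p annihilates the gl-regular operator L, and
    p = 0 if its degree is less than n. *)
Lemma gl_regular_unit_cyclic (R : realType) n (c : 'I_n -> 'M[R]_n) (E e : 'cV[R]_n) :
  associative (bilin c) -> left_id e (bilin c) -> gl_regular (left_mult c E) ->
  krylov (left_mult c E) e n \in unitmx.
Proof.
move=> cA c1 reg; set L := left_mult c E in reg *.
rewrite -unitmx_tr -row_free_unit -row_free_trP => v.
have [q sq ->] := colP_poly v; rewrite -(krylov_mxeval _ _ sq) => qe.
have LX k u w : bilin c (L ^+ k *m u) w = L ^+ k *m bilin c u w.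
  elim: k => [|k IH]; first by rewrite expr0 !mul1mx.
  rewrite exprS -[L * _]/(L *m _) -!mulmxA !left_mult_bilin -IH.
  by rewrite cA.
have qL : mxeval L q = 0.
  apply: mulmx_ext => u; rewrite mul0mx -{1}(c1 u).
  transitivity (bilin c (mxeval L q *m e) u); last by rewrite qe bilin0l.
  rewrite !(mxeval_vec _ _ sq).
  rewrite (big_morph (fun x => bilin c x u) (fun x y => bilinDl c x y u) (bilin0l c u)).
  by apply: eq_bigr => j _; rewrite bilinZl LX.
by rewrite (gl_regular_annihilator reg sq qL); apply/colP => j; rewrite !mxE coef0.
Qed.

(** * The correspondence on a manifold *)

Section Manifold.
Variables (R : realType) (s : smoothness) (n : nat) (M : manifold R s n).
Implicit Types (i j : chart_index M) (W : set M) (x : 'cV[R]_n).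

Lemma coordsS i W W' x : W `<=` W' -> coords i W x -> coords i W' x.
Proof. by move=> WW [p [ip Wp] <-]; exists p => //; split=> //; exact: WW. Qed.

Lemma coordsT i W x : coords i W x -> coords i [set: M] x.
Proof. exact: coordsS. Qed.

(** The image of W in a chart is the preimage of W under the continuous inverse of the
    chart, inside the open image of the chart. *)
Lemma open_coords i W : open W -> open (coords i W).
Proof.
move=> Wo.
have imo := @chart_img_open _ _ _ (atlas i).
have /subspace_continuousP ic := @chart_inv_cont _ _ _ (atlas i).
rewrite openE => x [p [ip Wp] px].
have imx : (chart_map (atlas i) @` chart_dom (atlas i)) x by exists p.
have invx : chart_inv (atlas i) x = p by rewrite -px chart_mapK.
have Wx : nbhs (chart_inv (atlas i) x) W by rewrite invx; exact: open_nbhs_nbhs.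
have nx : \near x, (chart_map (atlas i) @` chart_dom (atlas i)) x.
  exact: open_nbhs_nbhs.
have ix := ic x imx W Wx.
apply: filterS2 nx ix => y [q iq <-] Wq; exists q => //; split=> //.
have : W (chart_inv (atlas i) (chart_map (atlas i) q)).
  exact: Wq (ex_intro2 _ _ q iq erefl).
by rewrite chart_mapK.
Qed.

Lemma trans_coords i j x : coords i (dom j) x -> coords j [set: M] (trans i j x).
Proof.
move=> [p [ip jp] <-]; exists p => //.
by rewrite /trans /transition chart_mapK.
Qed.

Lemma differentiable_trans i j x : coords i (dom j) x -> differentiable (trans i j) x.
Proof. by move=> ijx; have [/(_ 1%N) [d _] _] := atlas_compat i j; exact: d. Qed.

Lemma is_vector_fieldS W W' (X : field_of M 'cV[R]_n) :
  W' `<=` W -> is_vector_field W X -> is_vector_field W' X.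
Proof.
move=> WW [cX tX]; split=> [i|i j x xW]; first by apply: of_classS (cX i) => x; exact: coordsS.
by apply: tX; apply: coordsS xW => p [? ?]; split=> //; exact: WW.
Qed.

Section FManifold.
Variable F : F_structure M.
Hypothesis HF : is_F_manifold F.
Notation a := (Defs.fprod F).
Notation e := (funit F).
Notation E := (feuler F).

Let open_chart i : open (coords i [set: M]).
Proof. exact/open_coords/openT. Qed.

Let app_euler i : app (euler_operator F i) = Defs.mul (a i) (E i).
Proof. by apply/funext => X; apply/funext => x; rewrite /app left_mult_bilin. Qed.

Lemma is_operator_field_euler : is_operator_field (euler_operator F).
Proof.
have [ca ta] := fprod_tensor HF; have [cE tE] := feuler_field HF.
split=> [i|i j x v xj].
  apply: of_class_sum => // k; apply: of_class_scale => //.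
  by have /of_classP := cE i; apply.
rewrite /euler_operator !left_mult_bilin tE; last by rewrite setIT.
exact: ta.
Qed.

Lemma near_fprod_unit i x : coords i [set: M] x ->
  \forall x \near x, left_id (e i x) (bilin (a i x)).
Proof. by move=> xi; apply: near_open xi (@fprod_unit _ _ _ _ _ HF i); exact: open_chart. Qed.

Lemma euler_defect_F W X Y i x :
  open W -> is_vector_field W X -> is_vector_field W Y -> coords i W x ->
  euler_defect (a i) (E i) (X i) (Y i) x = 0.
Proof.
move=> Wo vX vY xW; have := feuler_axiom HF Wo vX vY xW.
by rewrite /euler_defect /= => ->; rewrite subrr.
Qed.

Lemma is_nijenhuis_unity_euler : is_nijenhuis_unity (euler_operator F) e.
Proof.
split.
- exact: is_operator_field_euler.
- exact: funit_field HF.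
- move=> W X Y Wo vX vY i x xW.
  have xT := coordsT xW.
  have vE : is_vector_field W E by apply: is_vector_fieldS (feuler_field HF).
  rewrite /torsion app_euler.
  apply: (torsion_of_hm (fprod_comm HF xT) (fprod_assoc HF xT) (near_fprod_unit xT)).
  + exact: (fprod_hertling_manin HF Wo vE vX vE vY xW).
  + exact: (euler_defect_F Wo vE vX xW).
  + exact: (euler_defect_F Wo vE vY xW).
- move=> W X Wo vX i x xW.
  have xT := coordsT xW.
  have vE : is_vector_field W E by apply: is_vector_fieldS (feuler_field HF).
  have ve : is_vector_field W e by apply: is_vector_fieldS (funit_field HF).
  rewrite app_euler.
  apply: (lie_unity_of_hm (fprod_comm HF xT) (near_fprod_unit xT)).
  + exact: (fprod_hertling_manin HF Wo ve ve vE vX xW).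
  + exact: (euler_defect_F Wo ve ve xW).
Qed.

Lemma cyclic_unit_euler i x : coords i [set: M] x ->
  gl_regular (euler_operator F i x) -> cyclic_vector (euler_operator F i x) (e i x).
Proof.
move=> xT reg; apply/cyclic_vectorP.
exact: (gl_regular_unit_cyclic (fprod_assoc HF xT) (fprod_unit HF xT) reg).
Qed.

End FManifold.

Section Nijenhuis.
Variables (L : field_of M 'M[R]_n) (e : field_of M 'cV[R]_n).
Hypothesis HL : is_nijenhuis_unity L e.
Hypothesis Hc : forall i x, coords i [set: M] x -> cyclic_vector (L i x) (e i x).

Let open_chart i : open (coords i [set: M]).
Proof. exact/open_coords/openT. Qed.

Let Ku i x : coords i [set: M] x -> krylov (L i x) (e i x) n \in unitmx.
Proof. by move=> xT; apply/cyclic_vectorP; exact: Hc. Qed.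

(** The product determined by e being the unit and L the multiplication by the
    Euler field: the Euler field must be L e, and its k-th power L^k e. *)
Definition nijenhuis_F : F_structure M :=
  FStructure (fun i x => cyc_prod (L i x) (e i x)) e
    (fun i x => L i x *m e i x).

Lemma is_vector_field_mul W X : open W -> is_vector_field W X ->
  is_vector_field W (fun i => app (L i) (X i)).
Proof.
have [cL tL] := nijenhuis_operator HL.
move=> Wo [cX tX]; split=> [i|i j x xW].
  apply: of_class_mulmx => //; first exact: open_coords.
  by apply: of_classS (cL i) => x; exact: coordsT.
rewrite /app tX// tL//; apply: coordsS xW; exact: subIsetl.
Qed.

(** These are global vector fields, to which the hypotheses on L and e apply; they span
    the tangent space at each point. *)
Lemma is_vector_field_power k :
  is_vector_field [set: M] (fun i => power_field (L i) (e i) k).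
Proof.
elim: k => [|k IH].
  by under eq_fun do rewrite power_field0; exact: nijenhuis_unity HL.
by under eq_fun do rewrite power_fieldS; exact: is_vector_field_mul (@openT _) IH.
Qed.

Lemma lie_power_nijenhuis i x : coords i [set: M] x -> forall p q,
  lie (power_field (L i) (e i) p) (power_field (L i) (e i) q) x =
  (q%:R - p%:R) *: power_field (L i) (e i) (p + q).-1 x.
Proof.
move=> xT; apply: lie_power_field => [p q|q].
  exact: (nijenhuis_torsion HL (@openT _) (is_vector_field_power p)
    (is_vector_field_power q) xT).
exact: (nijenhuis_lie_unity HL (@openT _) (is_vector_field_power q) xT).
Qed.

Lemma of_class_power i k : of_class s (coords i [set: M]) (fun x => L i x ^+ k).
Proof.
have [cL _] := nijenhuis_operator HL.
elim: k => [|k IH]; first exact: of_class_cst.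
by under eq_fun do rewrite exprS; exact: of_class_mulmx.
Qed.

(** The coefficients of the polynomial in L are obtained by inverting the matrix with
    columns L^k e, whose determinant does not vanish. *)
Lemma of_class_cyc_prod i k :
  of_class s (coords i [set: M]) (fun x => cyc_prod (L i x) (e i x) k).
Proof.
apply: of_class_sum => // j; apply: of_class_scale => //; last exact: of_class_power.
suff /of_classP : of_class s (coords i [set: M])
    (fun x => invmx (krylov (L i x) (e i x) n) *m (delta_mx k 0 : 'cV_n)) by apply.
apply: of_class_mulmx => //; last exact: of_class_cst.
apply: of_class_invmx => //; first exact: Ku.
apply/of_classP => // l m.
have [+ _] := is_vector_field_power m => /(_ i)/of_classP - /(_ (@open_chart i) l 0).
by under [X in scalar_of_class _ _ X -> _]eq_fun do rewrite /power_field;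
   under [X in _ -> scalar_of_class _ _ X]eq_fun do rewrite mxE.
Qed.

Lemma nijenhuis_F_is_F_manifold : is_F_manifold nijenhuis_F.
Proof.
have [cL tL] := nijenhuis_operator HL; have [ce te] := nijenhuis_unity HL.
have dL i x : coords i [set: M] x -> differentiable (L i) x.
  by move=> xT; exact: (of_class_differentiable (cL i) xT).
have de i x : coords i [set: M] x -> differentiable (e i) x.
  by move=> xT; exact: (of_class_differentiable (ce i) xT).
have da i x : coords i [set: M] x -> forall k,
    differentiable (fun y => cyc_prod (L i y) (e i y) k) x.
  by move=> xT k; exact: (of_class_differentiable (of_class_cyc_prod i k) xT).
have dX W X i x : is_vector_field W X -> coords i W x -> differentiable (X i) x.
  by move=> [cX _] xW; exact: (of_class_differentiable (cX i) xW).
split=> /=.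
- split=> [i k|i j x u v xj]; first exact: of_class_cyc_prod.
  rewrite !bilin_cyc.
  apply: (cyc_mx_intertwine (Phi := fun w => 'D_w (trans i j) x)).
  + exact/Ku/(coordsT xj).
  + exact/Ku/trans_coords.
  + exact/derive_linear/differentiable_trans.
  + by move=> w; exact: tL.
  + by apply: te; rewrite setIT.
- exact: nijenhuis_unity HL.
- exact: is_vector_field_mul (@openT _) (nijenhuis_unity HL).
- by move=> i x xT; exact/cyc_comm/Ku.
- by move=> i x xT; exact/cyc_assoc/Ku.
- by move=> i x xT; exact/cyc_left_id/Ku.
- move=> W X Y Z T Wo vX vY vZ vT i x xW; have xT := coordsT xW.
  apply: (cyc_hertling_manin (@open_chart i) (@Ku i) (@lie_power_nijenhuis i) xT
    (dL _ _ xT) (de _ _ xT) (da _ _ xT)).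
  + exact: dX vX xW.
  + exact: dX vY xW.
  + exact: dX vZ xW.
  + exact: dX vT xW.
- move=> W X Y Wo vX vY i x xW; have xT := coordsT xW.
  apply: subr0_eq.
  exact: (cyc_euler (@open_chart i) (@Ku i) (@lie_power_nijenhuis i) xT
    (dL _ _ xT) (de _ _ xT) (da _ _ xT) (dX _ _ _ _ vX xW) (dX _ _ _ _ vY xW)).
Qed.

Lemma euler_operator_nijenhuis_F : agree (euler_operator nijenhuis_F) L.
Proof.
move=> i x xT; rewrite /euler_operator /= left_mult_cyc.
exact/cyc_mx_euler/Ku.
Qed.

Lemma regular_nijenhuis_F : regular_F nijenhuis_F.
Proof.
split; first exact: nijenhuis_F_is_F_manifold.
move=> i x xT; rewrite euler_operator_nijenhuis_F//.
exact: cyclic_gl_regular (Hc xT).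
Qed.

(** Multiplication by u in G commutes with L, the multiplication by the Euler field,
    and maps e to u; so it is [cyc_mx], by [cyc_mx_unique]. *)
Lemma nijenhuis_F_unique (G : F_structure M) : is_F_manifold G ->
  agree (euler_operator G) L -> agree (funit G) e -> F_agree G nijenhuis_F.
Proof.
move=> HG GL Ge.
have bE i x v : coords i [set: M] x -> L i x *m v = bilin (Defs.fprod G i x) (feuler G i x) v.
  by move=> xT; rewrite -GL// /euler_operator left_mult_bilin.
split=> // i x xT /=; last first.
  rewrite bE// -(Ge _ _ xT) (fprod_comm HG xT).
  by rewrite (fprod_unit HG xT).
apply/funext => k; rewrite -left_mult_delta; apply: cyc_mx_unique; first exact: Ku.
  apply: mulmx_ext => v; rewrite -!mulmxA !left_mult_bilin !bE//.
  by rewrite !(fprod_assoc HG xT) (fprod_comm HG xT (delta_mx k 0)).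
rewrite left_mult_bilin -(Ge _ _ xT) (fprod_comm HG xT).
by rewrite (fprod_unit HG xT).
Qed.

End Nijenhuis.
End Manifold.

Theorem theorem3p1 (R : realType) (s : smoothness) (n : nat)
    (M : manifold R s n) :
  (forall F : F_structure M, regular_F F ->
     nijenhuis_cyclic_unity (euler_operator F) (funit F)) /\
  (forall (L : field_of M 'M[R]_n) (e : field_of M 'cV[R]_n),
     nijenhuis_cyclic_unity L e ->
     exists F : F_structure M,
       [/\ regular_F F, agree (euler_operator F) L, agree (funit F) e
         & forall G : F_structure M, regular_F G ->
             agree (euler_operator G) L -> agree (funit G) e ->
             F_agree G F]).
Proof.
split=> [F [HF reg]|L e [HL Hc]].
  split; first exact: is_nijenhuis_unity_euler.
  by move=> i x xT; apply: cyclic_unit_euler => //; exact: reg.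
exists (nijenhuis_F L e); split.
- exact: regular_nijenhuis_F.
- exact: euler_operator_nijenhuis_F.
- by [].
- by move=> G [HG _]; exact: nijenhuis_F_unique.
Qed.
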